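(* Assume the henselianity conjecture: every valuation ring $\mathcal{O}$ that is NIP (as a structure in the language of rings) is henselian. Let $R$ be an NIP Noetherian ring. (1) $R$ is a direct product of finitely many henselian local rings. (2) If $R$ is an integral domain, then $R$ is a henselian local domain.
   Context: Rings are commutative and unital; a ring is NIP if the structure $(R,+,\cdot)$ has NIP theory. *)

(* Defs.v *)
From HB Require Import structures.
From mathcomp Require Import all_boot all_order all_algebra.
Set Implicit Arguments. Unset Strict Implicit. Unset Printing Implicit Defensive.
Import GRing.Theory.
Local Open Scope ring_scope.

Section Ideals.
Variable R : comPzRingType.

Definition is_ideal (I : R -> Prop) : Prop :=
  [/\ I 0, (forall x y, I x -> I y -> I (x + y)) & (forall r x, I x -> I (r * x))].

Definition proper_ideal (I : R -> Prop) : Prop := is_ideal I /\ ~ I 1.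

Definition maximal_ideal (m : R -> Prop) : Prop :=
  proper_ideal m /\
  forall J : R -> Prop, proper_ideal J -> (forall x, m x -> J x) -> forall x, J x -> m x.

Definition local_ring : Prop :=
  exists m, maximal_ideal m /\
    forall m', maximal_ideal m' -> forall x, m' x <-> m x.

Definition noetherian : Prop :=
  forall I : nat -> R -> Prop, (forall n, is_ideal (I n)) ->
    (forall n x, I n x -> I n.+1 x) ->
    exists N, forall n, (N <= n)%N -> forall x, I n x -> I N x.

Definition integral_domain : Prop :=
  (1 : R) <> 0 /\ forall a b : R, a * b = 0 -> a = 0 \/ b = 0.

Definition valuation_ring : Prop :=
  integral_domain /\ forall a b : R, (exists c, b = a * c) \/ (exists c, a = b * c).

End Ideals.

Definition henselian_local (A : comNzRingType) : Prop :=
  local_ring A /\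
  forall m : A -> Prop, maximal_ideal m ->
    forall (f : {poly A}) (a0 : A), f \is monic -> m f.[a0] -> ~ m (f^`()).[a0] ->
      exists a : A, root f a /\ m (a - a0).

Inductive rterm : Type :=
| RVar of nat
| RZero | ROne
| RAdd of rterm & rterm
| ROpp of rterm
| RMul of rterm & rterm.

Inductive rformula : Type :=
| FEq of rterm & rterm
| FNot of rformula
| FAnd of rformula & rformula
| FOr of rformula & rformula
| FExists of nat & rformula
| FForall of nat & rformula.

Section Semantics.
Variable R : comPzRingType.

Fixpoint teval (e : nat -> R) (t : rterm) : R :=
  match t with
  | RVar i => e i
  | RZero => 0
  | ROne => 1
  | RAdd u v => teval e u + teval e v
  | ROpp u => - teval e u
  | RMul u v => teval e u * teval e v
  end.

Definition upd (e : nat -> R) (i : nat) (x : R) : nat -> R :=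
  fun j => if j == i then x else e j.

Fixpoint fsat (e : nat -> R) (f : rformula) : Prop :=
  match f with
  | FEq u v => teval e u = teval e v
  | FNot g => ~ fsat e g
  | FAnd g h => fsat e g /\ fsat e h
  | FOr g h => fsat e g \/ fsat e h
  | FExists i g => exists x, fsat (upd e i x) g
  | FForall i g => forall x, fsat (upd e i x) g
  end.

(* the environment assigning a to the object variables x_0..x_{k-1}
   (indices < k) and b to the parameter variables (indices >= k) *)
Definition join_env (k : nat) (a b : nat -> R) : nat -> R :=
  fun j => if (j < k)%N then a j else b (j - k)%N.

Definition shatters (phi : rformula) (k n : nat) : Prop :=
  exists (a : 'I_n -> nat -> R) (b : {set 'I_n} -> nat -> R),
    forall (i : 'I_n) (S : {set 'I_n}), fsat (join_env k (a i) (b S)) phi <-> i \in S.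

Definition has_IP (phi : rformula) (k : nat) : Prop := forall n, shatters phi k n.

Definition NIP : Prop := forall phi k, ~ has_IP phi k.

End Semantics.

Definition henselianity_conjecture : Prop :=
  forall O : comNzRingType, valuation_ring O -> NIP O -> henselian_local O.

(* Main.v *)
From Pilot Require Import Defs.
From HB Require Import structures.
From mathcomp Require Import all_boot all_order all_algebra.
From mathcomp Require Import boolp classical_sets.
From mathcomp Require Import zify ring.
(* MathComp has another [proper_ideal]. *)
Import Pilot.Defs.
Set Implicit Arguments. Unset Strict Implicit. Unset Printing Implicit Defensive.
Import GRing.Theory.
Local Open Scope ring_scope.

(** Let [R] be an NIP Noetherian domain.

    If [a_1, ..., a_n] are such that no [a_i] divides the product of the others, then
    the formula "x divides y" shatters a set of size [n]; so NIP bounds [n].  This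
    bounds the number of maximal ideals, and it gives a nonzero [b] in the Jacobson
    radical such that all primes containing [b] are maximal: otherwise powers of suitable
    elements of the Jacobson radical form such families of any size.  By Krull's
    principal ideal theorem, [R] then has dimension at most one.

    In dimension one, [M / bM] has length at most [e = length (R / bR)] for every
    fractional ideal [M].  Applied to the modules generated by the powers of [x], this
    shows that each [x] in the fraction field is a root of a polynomial over [R] of
    degree at most [e] with a unit coefficient, and that an integral [x] is a root of a
    monic one.  So the integral closure [T] is definable, hence NIP, and its
    localizations at maximal ideals are definable valuation rings, henselian by
    hypothesis.  If [T] had two maximal ideals, an element close to [1] at the first one
    and to [0] at the second one would have roots of all orders [q ^ k] in [T], by
    Hensel's lemma at the first, against the length bound.  So [T] is local and
    henselian, and Nakayama's lemma brings roots of polynomials over [R] from [T] down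
    to [R].

    For a general ring, Noetherian induction reduces statements about ideals to prime
    quotients.  Each prime lies in only one maximal ideal, which splits [R] into local
    factors; Newton's method lifts roots through products of ideals. *)

(** * Rings from their laws, quotients, subrings, fraction fields *)

Record ring_laws (T : Type) := RingLaws {
  rl_zero : T; rl_opp : T -> T; rl_add : T -> T -> T;
  rl_one : T; rl_mul : T -> T -> T;
  rl_addA : associative rl_add; rl_addC : commutative rl_add;
  rl_add0 : left_id rl_zero rl_add; rl_addN : left_inverse rl_zero rl_opp rl_add;
  rl_mulA : associative rl_mul; rl_mulC : commutative rl_mul;
  rl_mul1 : left_id rl_one rl_mul; rl_mulD : left_distributive rl_mul rl_add;
  rl_neq : rl_one <> rl_zero }.

(** A copy of [T] tagged with the laws [d], so that structure inference on the tagged type finds the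
    ring given by [d]. *)
Definition law_carrier T (d : ring_laws T) : Type := T.

Section LawRing.
Variables (T : Type) (d : ring_laws T).
HB.instance Definition _ := gen_eqMixin (law_carrier d).
HB.instance Definition _ := gen_choiceMixin (law_carrier d).
HB.instance Definition _ := GRing.isZmodule.Build (law_carrier d)
  (@rl_addA _ d) (@rl_addC _ d) (@rl_add0 _ d) (@rl_addN _ d).
Lemma law_oner_neq0 : (rl_one d : law_carrier d) != 0.
Proof. by apply/eqP; apply: rl_neq. Qed.
HB.instance Definition _ := GRing.Zmodule_isComNzRing.Build (law_carrier d)
  (@rl_mulA _ d) (@rl_mulC _ d) (@rl_mul1 _ d) (@rl_mulD _ d) law_oner_neq0.
End LawRing.

Lemma rmorphism_of (R S : pzRingType) (f : R -> S) :
  {morph f : x y / x - y} -> {morph f : x y / x * y} -> f 1 = 1 ->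
  exists g : {rmorphism R -> S}, g =1 f.
Proof.
move=> fB fM f1.
pose zm := GRing.isZmodMorphism.Build R S f fB.
pose mm := GRing.isMonoidMorphism.Build R S f (f1, fM).
pose g : {rmorphism R -> S} :=
  HB.pack f zm mm.
by exists g.
Qed.

(** * Quotient rings and subrings *)

Section Ideals.
Variable R : comPzRingType.
Implicit Types I : R -> Prop.

Lemma ideal_opp I x : is_ideal I -> I x -> I (- x).
Proof. by case=> _ _ IM Ix; rewrite -mulN1r; apply: IM. Qed.

Lemma ideal_sub I x y : is_ideal I -> I x -> I y -> I (x - y).
Proof. by move=> hI Ix Iy; case: (hI) => _ IA _; apply: IA => //; apply: ideal_opp. Qed.

Lemma ideal_mulr I x y : is_ideal I -> I x -> I (x * y).
Proof. by case=> _ _ IM Ix; rewrite mulrC; apply: IM. Qed.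

(** The carrier consists of one chosen representative per coset: [r] is constant on cosets, and the
    quotient is the set of its fixed points. *)
Lemma quotient_ring I : proper_ideal I ->
  exists (Q : comNzRingType) (p : {rmorphism R -> Q}),
    (forall q, exists x, p x = q) /\ (forall x, p x = 0 <-> I x).
Proof.
move=> [hI I1]; have [I0 IA IM] := hI.
have [r rP] : exists r : R -> R, (forall x, I (r x - x)) /\
    (forall x y, I (x - y) -> r x = r y).
  (* Congruent elements have equal cosets as predicates, so [xget] picks the same representative for
     both. *)
  have e x y : I (x - y) -> (fun z => I (z - x)) = (fun z => I (z - y)).
    move=> Ixy; apply/funext => z; apply/propext; split=> h.
      by rewrite -(subrK x z) -addrA; apply: IA.
    by rewrite -(subrKA y) -[y - x]opprB; apply: IA => //; apply: ideal_opp.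
  exists (fun x => xget 0 (fun y => I (y - x))); split=> [x|x y /e ->] //.
  by case: xgetP => [_ -> //|/(_ x)]; rewrite subrr.
case: rP => rI rE.
have rr x : r (r x) = r x by apply: rE.
pose T := {x : R | r x = x}.
pose q x : T := exist _ (r x) (rr x).
have qE x y : I (x - y) -> q x = q y.
  by move=> /rE e; apply: eq_exist => /=.
have qK (t : T) : q (sval t) = t by case: t => x ex; apply: eq_exist.
have qI x : I (sval (q x) - x) by apply: rI.
have qEI x y : q x = q y -> I (x - y).
  move=> e; rewrite -(subrKA (sval (q x))) {2}e -[x - _]opprB.
  by apply: IA => //; apply: ideal_opp.
pose ad (s t : T) := q (sval s + sval t).
pose mu (s t : T) := q (sval s * sval t).
pose op (s : T) := q (- sval s).
have qD x y : ad (q x) (q y) = q (x + y).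
  by apply: qE; rewrite opprD addrACA; apply: IA.
have qM x y : mu (q x) (q y) = q (x * y).
  apply: qE; have -> : sval (q x) * sval (q y) - x * y =
    sval (q x) * (sval (q y) - y) + y * (sval (q x) - x) by ring.
  by apply: IA; apply: IM.
have qN x : op (q x) = q (- x).
  by apply: qE; rewrite -opprD; apply: ideal_opp.
have ind (P : T -> Prop) : (forall x, P (q x)) -> forall t, P t.
  by move=> h t; rewrite -(qK t).
have adA : associative ad.
  by elim/ind=> x; elim/ind=> y; elim/ind=> z; rewrite !qD addrA.
have adC : commutative ad by elim/ind=> x; elim/ind=> y; rewrite !qD addrC.
have ad0 : left_id (q 0) ad by elim/ind=> x; rewrite qD add0r.
have adN : left_inverse (q 0) op ad by elim/ind=> x; rewrite qN qD addNr.
have muA : associative mu.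
  by elim/ind=> x; elim/ind=> y; elim/ind=> z; rewrite !qM mulrA.
have muC : commutative mu by elim/ind=> x; elim/ind=> y; rewrite !qM mulrC.
have mu1 : left_id (q 1) mu by elim/ind=> x; rewrite qM mul1r.
have muD : left_distributive mu ad.
  by elim/ind=> x; elim/ind=> y; elim/ind=> z; rewrite qD !qM qD mulrDl.
have n1 : q 1 <> q 0 by move=> /qEI; rewrite subr0.
pose Q : comNzRingType := law_carrier (RingLaws adA adC ad0 adN muA muC mu1 muD n1).
have pB : {morph (q : R -> Q) : x y / x - y}.
  by move=> x y; rewrite -qD -qN.
have [p pE] := @rmorphism_of R Q q pB (fun x y => esym (qM x y)) (erefl _).
exists Q, p; split=> [t|x]; first by exists (sval t); rewrite pE qK.
rewrite pE; split=> [/qEI|Ix]; first by rewrite subr0.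
by apply: qE; rewrite subr0.
Qed.

End Ideals.

Lemma subring (K : comNzRingType) (P : K -> Prop) :
  P 1 -> (forall x y, P x -> P y -> P (x - y)) ->
  (forall x y, P x -> P y -> P (x * y)) ->
  exists (S : comNzRingType) (j : {rmorphism S -> K}),
    injective j /\ forall x, P x <-> exists s, j s = x.
Proof.
move=> P1 PB PM.
have P0 : P 0 by rewrite -(subrr 1); apply: PB.
have PN x : P x -> P (- x) by move=> Px; rewrite -sub0r; apply: PB.
have PD x y : P x -> P y -> P (x + y).
  by move=> Px Py; rewrite -[y]opprK; apply: PB => //; apply: PN.
pose T := {x : K | P x}.
have inj : injective (sval : T -> K).
  by move=> [x Px] [y Py] /= e; apply: eq_exist.
pose ad (s t : T) : T := exist P _ (PD _ _ (svalP s) (svalP t)).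
pose mu (s t : T) : T := exist P _ (PM _ _ (svalP s) (svalP t)).
pose op (s : T) : T := exist P _ (PN _ (svalP s)).
pose ze : T := exist P _ P0; pose on : T := exist P _ P1.
have adA : associative ad by move=> x y z; apply: inj; rewrite /= addrA.
have adC : commutative ad by move=> x y; apply: inj; rewrite /= addrC.
have ad0 : left_id ze ad by move=> x; apply: inj; rewrite /= add0r.
have adN : left_inverse ze op ad by move=> x; apply: inj; rewrite /= addNr.
have muA : associative mu by move=> x y z; apply: inj; rewrite /= mulrA.
have muC : commutative mu by move=> x y; apply: inj; rewrite /= mulrC.
have mu1 : left_id on mu by move=> x; apply: inj; rewrite /= mul1r.
have muD : left_distributive mu ad by move=> x y z; apply: inj; rewrite /= mulrDl.
have n1 : on <> ze by move=> /(congr1 sval) /= /eqP; rewrite oner_eq0.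
pose S : comNzRingType := law_carrier (RingLaws adA adC ad0 adN muA muC mu1 muD n1).
have [j jE] := @rmorphism_of S K (sval : T -> K) (fun _ _ => erefl _)
   (fun _ _ => erefl _) (erefl _).
exists S, j; split=> [x y|x]; first by rewrite !jE; apply: inj.
split=> [Px|[s <-]]; last by rewrite jE; apply: svalP.
by exists (exist P x Px); rewrite jE.
Qed.

(** Bundling the ring with the proof that it is a domain gives a key to which the structures
    required by [{fraction _}] can be attached, inverses being chosen classically. *)
Record domain := Domain { dom_ring :> comNzRingType; domP : integral_domain dom_ring }.
Definition dom_carrier (D : domain) : Type := dom_ring D.

Section DomainStructure.
Variable D : domain.
HB.instance Definition _ := GRing.ComNzRing.on (dom_carrier D).
Let unit (x : dom_carrier D) : bool := `[< exists y, y * x = 1 >].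
Let inv (x : dom_carrier D) := if unit x then xget 0 (fun y => y * x = 1) else x.
Lemma dom_mulVx : {in unit, left_inverse 1 inv *%R}.
Proof.
move=> x ux; have {}ux : unit x by exact: ux.
by rewrite /inv ux; move/asboolP: ux => [y yx]; case: xgetP => [_ -> //|/(_ y)].
Qed.
Lemma dom_unitPl x y : y * x = 1 -> unit x.
Proof. by move=> yx; apply/asboolP; exists y. Qed.
Lemma dom_invr_out : {in [predC unit], inv =1 id}.
Proof.
move=> x nux; have {}nux : ~~ unit x by exact: nux.
by rewrite /inv (negbTE nux).
Qed.
HB.instance Definition _ := GRing.ComNzRing_hasMulInverse.Build (dom_carrier D)
  dom_mulVx dom_unitPl dom_invr_out.
Lemma dom_mulf_eq0 (x y : dom_carrier D) : x * y = 0 -> (x == 0) || (y == 0).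
Proof. by case: (domP D) => _ h /h[] ->; rewrite eqxx ?orbT. Qed.
HB.instance Definition _ := GRing.ComUnitRing_isIntegral.Build (dom_carrier D)
  dom_mulf_eq0.
End DomainStructure.

Lemma fraction_field (R : comNzRingType) : integral_domain R ->
  exists (K : fieldType) (f : {rmorphism R -> K}), injective f /\
    forall x, exists a b, f b != 0 /\ x = f a / f b.
Proof.
move=> hR; pose D := Domain hR.
pose F : fieldType := {fraction (dom_carrier D)}.
pose i : R -> F := @FracField.tofrac (dom_carrier D).
have [g gE] := @rmorphism_of R F i
  (@tofracB (dom_carrier D)) (@tofracM (dom_carrier D)) (@tofrac1 (dom_carrier D)).
exists F, g; split=> [x y|x].
  by rewrite !gE => /eqP; rewrite /i tofrac_eq => /eqP.
elim/quotW: x => r; exists (frac r).1, (frac r).2.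
have d0 : g (frac r).2 != 0 by rewrite gE /i tofrac_eq0 denom_ratioP.
split=> //; apply: (canRL (mulfK d0)); rewrite !gE /i.
unlock FracField.tofrac; rewrite -[LHS]FracField.pi_mul.
apply/eqmodP; rewrite /= FracField.equivfE /FracField.mulf.
by rewrite !numden_Ratio ?mulf_neq0 ?oner_neq0 ?denom_ratioP // !mulr1 ?mul1r mulrC.
Qed.

(** * Interpretations preserve NIP *)

Lemma upd_same (R : comPzRingType) (e : nat -> R) i x : upd e i x i = x.
Proof. by rewrite /upd eqxx. Qed.

Lemma upd_neq (R : comPzRingType) (e : nat -> R) i x k :
  k != i -> upd e i x k = e k.
Proof. by rewrite /upd => /negbTE ->. Qed.

(* An element of the interpreted ring is represented by a pair: the variable [i] becomes
   the variables [4 i] (numerator) and [4 i + 1] (denominator).  The variables [4 i + 2]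
   hold the parameters of the interpretation and the variables [4 i + 3] are scratch. *)
Fixpoint den_term (t : rterm) : rterm :=
  match t with
  | RVar i => RVar (4 * i + 1)
  | RZero => ROne
  | ROne => ROne
  | RAdd u v => RMul (den_term u) (den_term v)
  | ROpp u => den_term u
  | RMul u v => RMul (den_term u) (den_term v)
  end.

Fixpoint num_term (t : rterm) : rterm :=
  match t with
  | RVar i => RVar (4 * i)
  | RZero => RZero
  | ROne => ROne
  | RAdd u v => RAdd (RMul (num_term u) (den_term v)) (RMul (num_term v) (den_term u))
  | ROpp u => ROpp (num_term u)
  | RMul u v => RMul (num_term u) (num_term v)
  end.

Section Translation.
Variables dom eqv : rformula.

(** [dom] reads its pair in the scratch variables 3 and 7, and [eqv] its two pairs in 3, 7, 11 and
    15. The translation copies values there first, which avoids substitution in formulas. *)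
Definition translate_dom (i : nat) : rformula :=
  FExists 3 (FExists 7 (FAnd (FEq (RVar 3) (RVar (4 * i)))
    (FAnd (FEq (RVar 7) (RVar (4 * i + 1))) dom))).

Definition translate_eq (u v : rterm) : rformula :=
  FExists 3 (FExists 7 (FExists 11 (FExists 15
    (FAnd (FEq (RVar 3) (num_term u)) (FAnd (FEq (RVar 7) (den_term u))
    (FAnd (FEq (RVar 11) (num_term v)) (FAnd (FEq (RVar 15) (den_term v)) eqv))))))).

Fixpoint translate (f : rformula) : rformula :=
  match f with
  | FEq u v => translate_eq u v
  | FNot g => FNot (translate g)
  | FAnd g h => FAnd (translate g) (translate h)
  | FOr g h => FOr (translate g) (translate h)
  | FExists i g => FExists (4 * i) (FExists (4 * i + 1) (FAnd (translate_dom i) (translate g)))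
  | FForall i g =>
      FForall (4 * i) (FForall (4 * i + 1) (FOr (FNot (translate_dom i)) (translate g)))
  end.
End Translation.

Section Interpretation.
Variables (R O K : comPzRingType) (j : {rmorphism O -> K}).
(** [val a b] is the element of [K] coded by the pair [(a, b)]. [good] singles out the denominators
    on which the arithmetic of pairs is valid, and [D] a set of pairs that code exactly the elements
    of [O]. *)
Variables (val : R -> R -> K) (good : R -> Prop) (D : R -> R -> Prop).
Variables (dom eqv : rformula) (w : nat -> R).
Hypothesis j_inj : injective j.
Hypothesis good1 : good 1.
Hypothesis goodM : forall b d, good b -> good d -> good (b * d).
Hypothesis val0 : val 0 1 = 0.
Hypothesis val1 : val 1 1 = 1.
Hypothesis valN : forall a b, good b -> val (- a) b = - val a b.
Hypothesis valD : forall a b c d, good b -> good d ->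
  val (a * d + c * b) (b * d) = val a b + val c d.
Hypothesis valM : forall a b c d, good b -> good d ->
  val (a * c) (b * d) = val a b * val c d.
Hypothesis D_good : forall a b, D a b -> good b /\ exists o, val a b = j o.
Hypothesis D_onto : forall o, exists a b, D a b /\ val a b = j o.
Hypothesis domE : forall e, (forall l, e (4 * l + 2)%N = w l) ->
  (fsat e dom <-> D (e 3%N) (e 7%N)).
Hypothesis eqvE : forall e, (forall l, e (4 * l + 2)%N = w l) ->
  good (e 7%N) -> good (e 15%N) ->
  (fsat e eqv <-> val (e 3%N) (e 7%N) = val (e 11%N) (e 15%N)).

Definition codes (e : nat -> R) (u : nat -> O) : Prop :=
  (forall l, e (4 * l + 2)%N = w l) /\
  forall l, D (e (4 * l)%N) (e (4 * l + 1)%N) /\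
            val (e (4 * l)%N) (e (4 * l + 1)%N) = j (u l).

Lemma teval_num_upd (e : nat -> R) k x t :
  teval (upd e (4 * k + 3) x) (num_term t) = teval e (num_term t) /\
  teval (upd e (4 * k + 3) x) (den_term t) = teval e (den_term t).
Proof.
elim: t => [i||| u [nu du] v [nv dv]|u [nu du]|u [nu du] v [nv dv]] //=.
- by rewrite !upd_neq //; lia.
- by rewrite nu nv du dv.
- by rewrite nu du.
- by rewrite nu nv du dv.
Qed.

Lemma codes_upd e u i a b o : codes e u -> D a b -> val a b = j o ->
  codes (upd (upd e (4 * i) a) (4 * i + 1) b) (upd u i o).
Proof.
move=> [ew eD] Dab vab; split=> l; first by rewrite !upd_neq ?ew //; lia.
have [->|li] := eqVneq l i.
  by rewrite !upd_same (@upd_neq _ (upd _ _ _) _ _ (4 * i)%N) ?upd_same //; lia.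
by rewrite !upd_neq //; lia.
Qed.

Lemma codes_teval e u t : codes e u ->
  good (teval e (den_term t)) /\
  val (teval e (num_term t)) (teval e (den_term t)) = j (teval u t).
Proof.
move=> [ew eD].
elim: t => [i||| s [gs vs] t [gt vt]|s [gs vs]|s [gs vs] t [gt vt]] /=.
- by have [/D_good[]] := eD i.
- by rewrite rmorph0.
- by rewrite rmorph1.
- by split; [apply: goodM|rewrite valD // vs vt rmorphD].
- by rewrite valN // vs rmorphN.
- by split; [apply: goodM|rewrite valM // vs vt rmorphM].
Qed.

Lemma translate_domE (e : nat -> R) i : (forall l, e (4 * l + 2)%N = w l) ->
  fsat e (translate_dom dom i) <-> D (e (4 * i)%N) (e (4 * i + 1)%N).
Proof.
move=> ew; rewrite /translate_dom /=.
have H x y : fsat (upd (upd e 3 x) 7 y) dom <-> D x y.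
  rewrite domE ?upd_same; first by rewrite upd_neq // upd_same.
  by move=> l; rewrite !upd_neq ?ew //; lia.
split=> [[x [y]]|h].
  by rewrite upd_neq // !upd_same !upd_neq; try lia; move=> [-> [-> /H]].
exists (e (4 * i)%N), (e (4 * i + 1)%N).
rewrite upd_neq // !upd_same !upd_neq; try lia.
by split=> //; split=> //; apply/H.
Qed.

Lemma translate_eqE e u s t : codes e u ->
  fsat e (translate_eq eqv s t) <-> teval u s = teval u t.
Proof.
move=> eu; rewrite /translate_eq /=.
pose e4 a b c d := upd (upd (upd (upd e 3 a) 7 b) 11 c) 15 d.
have E4 a b c d r : teval (e4 a b c d) (num_term r) = teval e (num_term r) /\
    teval (e4 a b c d) (den_term r) = teval e (den_term r).
  rewrite /e4; split.
    rewrite (proj1 (teval_num_upd _ 3 _ _)) (proj1 (teval_num_upd _ 2 _ _)).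
    by rewrite (proj1 (teval_num_upd _ 1 _ _)) (proj1 (teval_num_upd _ 0 _ _)).
  rewrite (proj2 (teval_num_upd _ 3 _ _)) (proj2 (teval_num_upd _ 2 _ _)).
  by rewrite (proj2 (teval_num_upd _ 1 _ _)) (proj2 (teval_num_upd _ 0 _ _)).
have V a b c d : [/\ e4 a b c d 3%N = a, e4 a b c d 7%N = b,
    e4 a b c d 11%N = c & e4 a b c d 15%N = d] by [].
have [gs vs] := codes_teval s eu; have [gt vt] := codes_teval t eu.
have H a b c d : good b -> good d ->
    fsat (e4 a b c d) eqv <-> val a b = val c d.
  move=> gb gd; have [V1 V2 V3 V4] := V a b c d.
  rewrite eqvE ?V1 ?V2 ?V3 ?V4 //.
  by move=> l; rewrite /e4 !upd_neq; try lia; case: eu.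
split=> [[a [b [c [d]]]]|h].
  rewrite -/(e4 a b c d); have [-> -> -> ->] := V a b c d.
  rewrite !(proj1 (E4 a b c d _)) !(proj2 (E4 a b c d _)) => -[-> [-> [-> [->]]]].
  by move/H => /(_ gs gt); rewrite vs vt => /j_inj.
exists (teval e (num_term s)), (teval e (den_term s)).
exists (teval e (num_term t)), (teval e (den_term t)).
set a := teval e (num_term s); set b := teval e (den_term s).
set c := teval e (num_term t); set d := teval e (den_term t).
rewrite -/(e4 a b c d); have [-> -> -> ->] := V a b c d.
rewrite !(proj1 (E4 a b c d _)) !(proj2 (E4 a b c d _)).
by do 4 split=> //; apply/H => //; rewrite /a /b /c /d vs vt h.
Qed.

Lemma translateE f e u : codes e u -> fsat e (translate dom eqv f) <-> fsat u f.
Proof.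
elim: f e u => [s t|g IH|g IHg h IHh|g IHg h IHh|i g IH|i g IH] e u eu /=.
- exact: translate_eqE.
- by rewrite (IH _ _ eu).
- by rewrite (IHg _ _ eu) (IHh _ _ eu).
- by rewrite (IHg _ _ eu) (IHh _ _ eu).
- have Dx a b : fsat (upd (upd e (4 * i) a) (4 * i + 1) b) (translate_dom dom i) <-> D a b.
    rewrite translate_domE ?upd_same; last first.
      by move=> l; rewrite !upd_neq; try lia; case: eu.
    by rewrite upd_neq ?upd_same //; lia.
  split=> [[a [b [/Dx Dab gab]]]|[o go]].
    have [_ [o vo]] := D_good Dab; exists o.
    by apply/(IH _ _ (codes_upd i eu Dab vo)).
  have [a [b [Dab vo]]] := D_onto o; exists a, b; split; first exact/Dx.
  by apply/(IH _ _ (codes_upd i eu Dab vo)).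
- have Dx a b : fsat (upd (upd e (4 * i) a) (4 * i + 1) b) (translate_dom dom i) <-> D a b.
    rewrite translate_domE ?upd_same; last first.
      by move=> l; rewrite !upd_neq; try lia; case: eu.
    by rewrite upd_neq ?upd_same //; lia.
  split=> [h o|h a b].
    have [a [b [Dab vo]]] := D_onto o.
    apply/(IH _ _ (codes_upd i eu Dab vo)).
    by case: (h a b) => // -[]; apply/Dx.
  have [Dab|nD] := pselect (D a b); last by left=> /Dx.
  have [_ [o vo]] := D_good Dab; right.
  by apply/(IH _ _ (codes_upd i eu Dab vo)).
Qed.

(** A configuration shattered by [f] in [O] is coded in [R], where the translation of [f] shatters
    it. Each variable becomes a block of four, so [k] object variables become [4 * k]. *)
Lemma NIP_interpretation : NIP R -> NIP O.
Proof.
move=> hR f k hf; apply: (hR (translate dom eqv f) (4 * k)%N) => n.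
have [a [b ab]] := hf n.
have /choice[r rP] : forall o, exists p : R * R, D p.1 p.2 /\ val p.1 p.2 = j o.
  by move=> o; have [x [y xy]] := D_onto o; exists (x, y).
pose enc (u : nat -> O) (m : nat) : R :=
  match (m %% 4)%N with
  | 0%N => (r (u (m %/ 4)%N)).1 | 1%N => (r (u (m %/ 4)%N)).2
  | 2%N => w (m %/ 4)%N | _ => 0 end.
have encP u : codes (enc u) u.
  split=> l; rewrite /enc.
    have -> : ((4 * l + 2) %% 4 = 2)%N by lia.
    by have -> : ((4 * l + 2) %/ 4 = l)%N by lia.
  have -> : ((4 * l + 1) %% 4 = 1)%N by lia.
  have -> : ((4 * l + 1) %/ 4 = l)%N by lia.
  have -> : ((4 * l) %% 4 = 0)%N by lia.
  by have -> : ((4 * l) %/ 4 = l)%N by lia.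
(* Joining the two coded environments gives the code of the joined environment, because a cut at
   [4 * k] splits no block. *)
exists (fun i => enc (a i)), (fun S m => enc (fun l => b S (l - k)%N) (m + 4 * k)%N).
move=> i S; rewrite -ab -(translateE f (encP _)).
suff -> : join_env (4 * k) (enc (a i))
    (fun m => enc (fun l => b S (l - k)%N) (m + 4 * k)%N) =
    enc (join_env k (a i) (b S)) by [].
apply/funext => m; rewrite /join_env; case: ltnP => mk.
  have e : (m %/ 4 < k)%N by lia.
  by rewrite /enc e.
have e : (m %/ 4 < k)%N = false by lia.
by rewrite subnK // /enc e.
Qed.

End Interpretation.

(** * Divisibility under NIP; definable quotients and rings of fractions *)

Lemma NIP_divides (R : comPzRingType) : NIP R ->
  exists n, forall a : 'I_n -> R, exists i r, r * a i = \prod_(k | k != i) a k.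
Proof.
move=> hR.
pose phi := FExists 2 (FEq (RVar 1) (RMul (RVar 2) (RVar 0))).
have /existsNP[n hn] := hR phi 1%N; exists n => a.
apply: contrapT => na; apply: hn.
(* The set [S] is coded by the product of its [a k]. If [i] is not in [S], this product divides that
   of all [a k] with [k != i], so [a i] cannot divide it. *)
exists (fun i _ => a i), (fun (S : {set 'I_n}) _ => \prod_(k in S) a k) => i S /=.
rewrite /upd /join_env /=; split=> [[z e]|iS].
  apply: contrapT => /negP niS; apply: na.
  exists i, (z * \prod_(k | (k != i) && (k \notin S)) a k).
  rewrite mulrAC -e [RHS](bigID (mem S)) /=; congr (_ * _).
  apply: eq_bigl => k; case: (boolP (k \in S)) => [kS|]; rewrite ?andbT ?andbF //.
  by apply/esym/eqP => ki; rewrite -ki kS in niS.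
by exists (\prod_(k in S | k != i) a k); rewrite (bigD1 i) //= mulrC.
Qed.

(** Quantifies the scratch variables [4 * l + 19] for [l < n]; starting at 19 leaves 3, 7, 11 and 15
    to the copied pairs. *)
Fixpoint exs (n : nat) (f : rformula) : rformula :=
  match n with 0%N => f | n'.+1 => FExists (4 * n' + 19) (exs n' f) end.

Definition with_scratch (R : comPzRingType) (e : nat -> R) (n : nat) (c : nat -> R)
    (m : nat) : R :=
  if (m %% 4 == 3)%N && (4 <= m %/ 4 < n + 4)%N then c (m %/ 4 - 4)%N else e m.

Lemma exsE (R : comPzRingType) (e : nat -> R) n f :
  fsat e (exs n f) <-> exists c, fsat (with_scratch e n c) f.
Proof.
elim: n e => [|n IH] e /=.
  have E c : with_scratch e 0 c = e.
    apply/funext => m; rewrite /with_scratch.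
    have -> : (4 <= m %/ 4 < 0 + 4)%N = false by lia.
    by rewrite andbF.
  by split=> [h|[c]]; first exists e; rewrite E.
have E x c : with_scratch (upd e (4 * n + 19) x) n c = with_scratch e n.+1 (upd c n x).
  apply/funext => m; rewrite /with_scratch /upd.
  have [->|mn] := eqVneq m (4 * n + 19)%N.
    have -> : ((4 * n + 19) %% 4 = 3)%N by lia.
    have -> : ((4 * n + 19) %/ 4 = n + 4)%N by lia.
    have -> : (4 <= n + 4 < n + 4)%N = false by lia.
    have -> : (4 <= n + 4 < n.+1 + 4)%N by lia.
    by rewrite addnK !eqxx.
  case: eqP => //= m3.
  have [h|h] := ltnP (m %/ 4) 4; first by [].
  have -> : (m %/ 4 - 4 == n)%N = false by lia.
  by have -> : (m %/ 4 < n + 4)%N = (m %/ 4 < n.+1 + 4)%N by lia.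
split=> [[x /IH[c]]|[c h]].
  by rewrite E; exists (upd c n x).
exists (c n); apply/IH; exists c; rewrite E.
suff -> : upd c n (c n) = c by [].
by apply/funext => m; rewrite /upd; case: eqP => [->|].
Qed.

Lemma with_scratch_param (R : comPzRingType) (e : nat -> R) n c l :
  with_scratch e n c (4 * l + 2)%N = e (4 * l + 2)%N.
Proof. by rewrite /with_scratch; have -> : ((4 * l + 2) %% 4 = 2)%N by lia. Qed.

Lemma with_scratch_low (R : comPzRingType) (e : nat -> R) n c m :
  (m < 16)%N -> with_scratch e n c m = e m.
Proof.
move=> hm; rewrite /with_scratch.
have -> : (4 <= m %/ 4 < n + 4)%N = false by lia.
    by rewrite andbF.
Qed.

Lemma with_scratch_new (R : comPzRingType) (e : nat -> R) n c l :
  (l < n)%N -> with_scratch e n c (4 * l + 19)%N = c l.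
Proof.
move=> ln; rewrite /with_scratch.
have -> : ((4 * l + 19) %% 4 = 3)%N by lia.
have -> : ((4 * l + 19) %/ 4 = l + 4)%N by lia.
by rewrite leq_addl ltn_add2r ln addnK.
Qed.

Fixpoint sum_term (n : nat) (F : nat -> rterm) : rterm :=
  match n with 0%N => RZero | n'.+1 => RAdd (sum_term n' F) (F n') end.

Fixpoint pow_term (t : rterm) (n : nat) : rterm :=
  match n with 0%N => ROne | n'.+1 => RMul t (pow_term t n') end.

Lemma teval_sum (R : comPzRingType) (e : nat -> R) n F :
  teval e (sum_term n F) = \sum_(i < n) teval e (F i).
Proof. by elim: n => [|n IH]; rewrite ?big_ord0 // big_ord_recr /= IH. Qed.

Lemma teval_pow (R : comPzRingType) (e : nat -> R) t n :
  teval e (pow_term t n) = teval e t ^+ n.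
Proof. by elim: n => [|n IH]; rewrite ?expr0 // exprS /= IH. Qed.

(** All denominators are [1], and congruence modulo the kernel is definable with its generators [g]
    as parameters. *)
Lemma NIP_quotient (R : comPzRingType) (Q : comNzRingType) (p : {rmorphism R -> Q})
    n (g : nat -> R) :
  (forall q, exists x, p x = q) ->
  (forall x, p x = 0 <-> exists c : nat -> R, x = \sum_(i < n) c i * g i) ->
  NIP R -> NIP Q.
Proof.
move=> ponto pker.
pose eqv := exs n (FEq (RAdd (RVar 3) (ROpp (RVar 11)))
   (sum_term n (fun i => RMul (RVar (4 * i + 19)) (RVar (4 * i + 2))))).
apply: (@NIP_interpretation R Q Q [the {rmorphism Q -> Q} of idfun]
  (fun a b => p a) (fun b => b = 1) (fun a b => b = 1)
  (FEq (RVar 7) ROne) eqv g) => //.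
- by move=> b d -> ->; rewrite mulr1.
- exact: rmorph0.
- exact: rmorph1.
- by move=> a b _; rewrite rmorphN.
- by move=> a b c d -> ->; rewrite !mulr1 rmorphD.
- by move=> a b c d _ _; rewrite rmorphM.
- by move=> a b ->; split=> //; exists (p a).
- by move=> q; have [x <-] := ponto q; exists x, 1.
move=> e ew e7 e15; rewrite exsE.
have -> : (p (e 3%N) = p (e 11%N)) <-> p (e 3%N - e 11%N) = 0.
  by rewrite rmorphB; split=> [->|/subr0_eq //]; rewrite subrr.
rewrite pker.
have E c : fsat (with_scratch e n c) (FEq (RAdd (RVar 3) (ROpp (RVar 11)))
   (sum_term n (fun i => RMul (RVar (4 * i + 19)) (RVar (4 * i + 2))))) <->
   e 3%N - e 11%N = \sum_(i < n) c i * g i.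
  cbn [fsat teval]; rewrite teval_sum !with_scratch_low //.
  rewrite (eq_bigr (fun i : 'I_n => c i * g i)) // => i _.
  by cbn [teval]; rewrite with_scratch_param with_scratch_new // ew.
by split=> -[c h]; exists c; apply/E.
Qed.

(** Pairs are read as fractions, whose equality is cross-multiplication. Only a set [D] of fractions
    representing the elements of [S] has to be defined by a formula. *)
Lemma NIP_fractions (R S : comNzRingType) (K : fieldType) (f : {rmorphism R -> K})
    (j : {rmorphism S -> K}) (D : R -> R -> Prop) dom (w : nat -> R) :
  injective f -> injective j ->
  (forall a b, D a b -> b <> 0) ->
  (forall x, (exists s, j s = x) <-> exists a b, D a b /\ x = f a / f b) ->
  (forall e, (forall l, e (4 * l + 2)%N = w l) -> (fsat e dom <-> D (e 3%N) (e 7%N))) ->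
  NIP R -> NIP S.
Proof.
move=> f_inj j_inj D0 DS domE.
have f0 b : b <> 0 -> f b != 0.
  by move=> b0; apply/eqP => fb; apply: b0; apply: f_inj; rewrite fb rmorph0.
apply: (@NIP_interpretation R S K j (fun a b => f a / f b) (fun b => b <> 0) D
  dom (FEq (RMul (RVar 3) (RVar 15)) (RMul (RVar 11) (RVar 7))) w) => //.
- by apply/eqP; apply: oner_neq0.
- move=> b d /f0 b0 /f0 d0 bd.
  by have := mulf_neq0 b0 d0; rewrite -rmorphM bd rmorph0 eqxx.
- by rewrite rmorph0 mul0r.
- by rewrite rmorph1 divr1.
- by move=> a b _; rewrite rmorphN mulNr.
- by move=> a b c d /f0 b0 /f0 d0; rewrite rmorphD !rmorphM addf_div.
- by move=> a b c d /f0 b0 /f0 d0; rewrite !rmorphM mulf_div.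
- move=> a b Dab; split; first exact: D0 Dab.
  have /DS[s js] : exists a0 b0, D a0 b0 /\ f a / f b = f a0 / f b0 by exists a, b.
  by exists s.
- move=> s; have /DS[a [b [Dab js]]] : exists s0, j s0 = j s by exists s.
  by exists a, b.
move=> e _ /f0 e7 /f0 e15 /=; split=> [h|/eqP].
  by apply/eqP; rewrite eqr_div // -!rmorphM h.
by rewrite eqr_div // -!rmorphM => /eqP /f_inj.
Qed.

(** * Ideals of Noetherian and of NIP rings *)

Section IdealTheory.
Variable R : comPzRingType.
Implicit Types I J P : R -> Prop.

Definition prime_ideal P :=
  [/\ is_ideal P, ~ P 1 & forall a b, P (a * b) -> P a \/ P b].

Definition ideal_adjoin I x : R -> Prop := fun y => exists u r, I u /\ y = u + r * x.

Lemma zero_ideal : is_ideal (fun x : R => x = 0).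
Proof. by split=> // [x y -> ->|r x ->]; rewrite ?addr0 ?mulr0. Qed.

Lemma ideal_adjoinP I x : is_ideal I -> is_ideal (ideal_adjoin I x).
Proof.
move=> [I0 IA IM]; split.
- by exists 0, 0; rewrite mul0r addr0.
- move=> _ _ [u [r [Iu ->]]] [v [s [Iv ->]]].
  by exists (u + v), (r + s); split; [apply: IA|ring].
- move=> t _ [u [r [Iu ->]]].
  by exists (t * u), (t * r); split; [apply: IM|ring].
Qed.

Lemma ideal_adjoinS I x y : I y -> ideal_adjoin I x y.
Proof. by move=> Iy; exists y, 0; rewrite mul0r addr0. Qed.

Lemma ideal_adjoin_gen I x : is_ideal I -> ideal_adjoin I x x.
Proof. by case=> I0 _ _; exists 0, 1; rewrite mul1r add0r. Qed.

Lemma ideal_eq1 I x : is_ideal I -> I 1 -> I x.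
Proof. by case=> _ _ IM I1; rewrite -[x]mulr1; apply: IM. Qed.

Lemma maximal_comaximal (m : R -> Prop) I : maximal_ideal m -> is_ideal I ->
  ~ (forall x, I x -> m x) -> exists x, m x /\ I (1 - x).
Proof.
move=> [[hm m1] mmax] hI nI; apply: contrapT => h; apply: nI.
pose J x := exists u v, [/\ m u, I v & x = u + v].
have [m0 mA mM] := hm; have [I0 IA IM] := hI.
have hJ : is_ideal J.
  split; first by exists 0, 0; rewrite addr0.
    move=> _ _ [u [v [mu Iv ->]]] [u' [v' [mu' Iv' ->]]].
    by exists (u + u'), (v + v'); split; [exact: mA|exact: IA|rewrite addrACA].
  move=> r _ [u [v [mu Iv ->]]].
  by exists (r * u), (r * v); split; [exact: mM|exact: IM|rewrite mulrDr].
have JI x : I x -> J x by move=> Ix; exists 0, x; split; rewrite ?add0r.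
have mJ x : m x -> J x by move=> mx; exists x, 0; split; rewrite ?addr0.
move=> x /JI; apply: mmax => //; split=> // -[u [v [mu Iv e]]].
by apply: h; exists u; split=> //; rewrite e addrC addKr.
Qed.

Lemma maximal_prime (m : R -> Prop) : maximal_ideal m -> prime_ideal m.
Proof.
move=> mx; have [[hm m1] mmax] := mx; split=> // a b mab.
have [ma|na] := pselect (m a); [by left|right].
have hI : is_ideal (ideal_adjoin m a) by apply: ideal_adjoinP.
have [x [mxx [u [r [mu e]]]]] : exists x, m x /\ ideal_adjoin m a (1 - x).
  apply: maximal_comaximal => // h; apply: na; apply: h; exact: ideal_adjoin_gen.
have -> : b = (x + u) * b + r * (a * b).
  by rewrite -[LHS]mul1r -(subrK x 1) e; ring.
case: hm => _ mA mM; apply: (mA); last exact: mM.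
by rewrite mulrC; apply: mM; apply: mA.
Qed.

Lemma maximal_inj (m m' : R -> Prop) : maximal_ideal m -> maximal_ideal m' ->
  (forall x, m x -> m' x) -> m = m'.
Proof.
move=> [_ mmax] [pm' _] h; apply/funext => x; apply/propext; split; first exact: h.
exact: mmax.
Qed.

Lemma distinct_comaximal (m m' : R -> Prop) : maximal_ideal m -> maximal_ideal m' -> m <> m' ->
  exists x, m x /\ m' (1 - x).
Proof.
move=> mm mm' neq; apply: maximal_comaximal => //; first by case: mm' => -[].
by move=> h; apply: neq; rewrite (maximal_inj mm' mm h).
Qed.

Lemma exists_maximal I : proper_ideal I ->
  exists m, maximal_ideal m /\ forall x, I x -> m x.
Proof.
move=> pI.
pose P (A : set R) := A = set0 \/ (proper_ideal A /\ forall x, I x -> A x).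
have [|A [PA Amax]] := @Zorn_bigcup R P.
  move=> F FP Ftot.
  have [[A0 FA0 [pA0 IA0]]|nF] := pselect (exists2 A, F A &
      proper_ideal A /\ forall x, I x -> A x); last first.
    left; rewrite -subset0 => x [A FA Ax]; apply: nF; exists A => //.
    by case: (FP _ FA) => // A0; rewrite A0 in Ax.
  have prop A x : F A -> A x -> proper_ideal A.
    by move=> FA Ax; case: (FP _ FA) => [A0'|[]//]; rewrite A0' in Ax.
  right; split=> [|x Ix]; last by exists A0 => //; apply: IA0.
  split; last by move=> [A FA A1]; have [_] := prop _ _ FA A1; apply.
  split; first by exists A0 => //; case: pA0 => -[].
  - move=> x y [A FA Ax] [B FB By].
    case: (Ftot _ _ FA FB) => AB.
      exists B => //; have [[_ BA _] _] := prop _ _ FB By; apply: BA => //.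
      exact: AB.
    exists A => //; have [[_ AA _] _] := prop _ _ FA Ax; apply: AA => //.
    exact: AB.
  - move=> r x [A FA Ax]; exists A => //.
    by have [[_ _ AM] _] := prop _ _ FA Ax; apply: AM.
have [I0 _ _] := proj1 pI.
have neA : A <> set0.
  move=> A0; apply: (Amax I); last by right.
  by rewrite A0; split=> [x //|/(_ _ I0)].
case: PA => // -[pA IA]; exists A; split=> //; split=> // J pJ AJ x Jx.
apply: contrapT => nAx; apply: (Amax J).
  by split=> [y /AJ //|/(_ _ Jx)].
by right; split=> // y /IA /AJ.
Qed.

(** * Noetherian induction and finite generation *)

Section Noetherian.
Hypothesis noeth : noetherian R.

(** A counterexample could always be enlarged to another one, which would give a strictly increasing
    sequence of ideals. *)
Lemma noeth_ind (Q : (R -> Prop) -> Prop) :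
  (forall I, is_ideal I ->
     (forall J, is_ideal J -> (forall x, I x -> J x) ->
       (exists x, J x /\ ~ I x) -> Q J) -> Q I) ->
  forall I, is_ideal I -> Q I.
Proof.
move=> step I hI; apply: contrapT => nQ.
pose T := {I : R -> Prop | is_ideal I /\ ~ Q I}.
have /choice[next nextP] : forall t : T, exists t' : T,
    (forall x, sval t x -> sval t' x) /\ (exists x, sval t' x /\ ~ sval t x).
  move=> [J [hJ nQJ]]; apply: contrapT => h; apply: (nQJ); apply: step => // J' hJ' JJ' ex.
  apply: contrapT => nQJ'; apply: h.
  by exists (exist _ J' (conj hJ' nQJ')).
pose t0 : T := exist _ I (conj hI nQ).
pose c n := sval (iter n next t0).
have [||N hN] := noeth (I := c).
- by move=> n; rewrite /c; case: (iter n next t0) => J [].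
- by move=> n x; rewrite /c iterS; apply: (nextP _).1.
have [x [xN nx]] := (nextP (iter N next t0)).2.
by apply: nx; apply: (hN N.+1).
Qed.

(** An ideal that is neither prime nor the whole ring contains a product [a * b] of two elements
    outside it, and adjoining either factor gives a strictly larger ideal. *)
Lemma noeth_prime_ind (Q : (R -> Prop) -> Prop) :
  (forall I, is_ideal I -> I 1 -> Q I) ->
  (forall P, prime_ideal P -> Q P) ->
  (forall I a b, is_ideal I -> I (a * b) ->
     Q (ideal_adjoin I a) -> Q (ideal_adjoin I b) -> Q I) ->
  forall I, is_ideal I -> Q I.
Proof.
move=> Q1 Qp Qs; apply: noeth_ind => I hI IH.
have [I1|n1] := pselect (I 1); first exact: Q1.
have [pI|] := pselect (forall a b, I (a * b) -> I a \/ I b); first exact: Qp.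
move=> /existsNP[a /existsNP[b /not_implyP[Iab /not_orP[na nb]]]].
apply: (Qs I a b) => //; apply: IH.
- exact: ideal_adjoinP.
- exact: ideal_adjoinS.
- by exists a; split=> //; apply: ideal_adjoin_gen.
- exact: ideal_adjoinP.
- exact: ideal_adjoinS.
- by exists b; split=> //; apply: ideal_adjoin_gen.
Qed.

(** Starting from the zero ideal, elements of [I] outside the current finitely generated ideal are
    adjoined; Noetherian induction makes this stop. *)
Lemma noeth_fg I : is_ideal I -> exists n (g : nat -> R),
  forall x, I x <-> exists c : nat -> R, x = \sum_(i < n) c i * g i.
Proof.
move=> hI.
pose fg J := exists n (g : nat -> R),
  forall x, J x <-> exists c : nat -> R, x = \sum_(i < n) c i * g i.
pose Q J := (forall x, J x -> I x) -> fg J -> fg I.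
suff: Q (fun x => x = 0).
  apply; first by move=> _ ->; case: hI.
  exists 0%N, (fun _ => 0) => x; split=> [->|[c ->]]; rewrite ?big_ord0 //.
  by exists (fun _ => 0); rewrite big_ord0.
apply: noeth_ind; last exact: zero_ideal.
move=> J hJ IH JI [n [g gP]].
have [IJ|/existsNP[x /not_implyP[Ix nJx]]] := pselect (forall x, I x -> J x).
  by exists n, g => x; rewrite -gP; split; [apply: IJ|apply: JI].
apply: (IH (ideal_adjoin J x)).
- exact: ideal_adjoinP.
- exact: ideal_adjoinS.
- by exists x; split=> //; apply: ideal_adjoin_gen.
- move=> _ [u [r [Ju ->]]]; have [_ IA IM] := hI.
  by apply: IA; [apply: JI|apply: IM].
exists n.+1, (fun i => if i == n then x else g i) => y.
have E (c : nat -> R) : \sum_(i < n.+1) c i * (if i == n :> nat then x else g i) =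
    \sum_(i < n) c i * g i + c n * x :> R.
  rewrite big_ord_recr /= eqxx; congr (_ + _); apply: eq_bigr => i _.
  by rewrite ltn_eqF.
split=> [[u [r [/gP[c ->] ->]]]|[c ->]].
  pose c' i := if i == n then r else c i.
  exists c'; rewrite E /c' eqxx; congr (_ + _).
  by apply: eq_bigr => i _; rewrite ltn_eqF.
by rewrite E; exists (\sum_(i < n) c i * g i), (c n); split=> //; apply/gP; exists c.
Qed.

End Noetherian.

(** * Separation and finiteness of maximal ideals *)

Definition is_maximal_family n (m : nat -> R -> Prop) :=
  (forall i, (i < n)%N -> maximal_ideal (m i)) /\
  (forall i k, (i < n)%N -> (k < n)%N -> i <> k -> m i <> m k).

(** Chinese remainders: [1 - a] is a product of elements congruent to [1] modulo [m i], one taken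
    from each other [m k]. *)
Lemma maximal_separator n (m : nat -> R -> Prop) i : is_maximal_family n m -> (i < n)%N ->
  exists a, m i a /\ forall k, (k < n)%N -> k <> i -> m k (1 - a).
Proof.
move=> [mM mD] iN.
have /choice[u uP] : forall k : nat, exists x, (k < n)%N -> k <> i -> m i x /\ m k (1 - x).
  move=> k; have [kn|] := pselect (k < n)%N; last by exists 0.
  have [ki|ki] := pselect (k = i); first by exists 0.
  have [|x xP] := distinct_comaximal (mM _ iN) (mM _ kn); last by exists x.
  by apply: mD => // /esym.
have [[hi _] _] := mM _ iN.
exists (1 - \prod_(k < n | k != i :> nat) (1 - u k)); split.
  apply: (big_ind (fun x => m i (1 - x))).
  - by rewrite subrr; case: hi.
  - move=> x y mx my; have -> : 1 - x * y = (1 - x) + x * (1 - y) by ring.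
    by have [_ A M] := hi; apply: A => //; apply: M.
  - move=> k ki; rewrite opprB addrC subrK.
    by have [] := uP k (ltn_ord k) (elimN eqP ki).
move=> k kn ki; rewrite opprB addrC subrK.
rewrite (bigD1 (Ordinal kn)) /=; last exact/eqP.
apply: (@ideal_mulr _ (m k)); first by have [[]] := mM _ kn.
by have [] := uP k kn ki.
Qed.

(* If [a_i] lies in the [i]-th of [n] distinct maximal ideals only, then no [a_i] divides
   the product of the others. *)
Lemma NIP_finite_maximal : NIP R -> exists n (m : nat -> R -> Prop), is_maximal_family n m /\
  forall M, maximal_ideal M -> exists i, (i < n)%N /\ M = m i.
Proof.
move=> /NIP_divides[N hN]; apply: contrapT => h.
have all n : exists m : nat -> R -> Prop, is_maximal_family n m.
  elim: n => [|n [m mP]]; first by exists (fun _ _ => True); split.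
  have [M MM nM] : exists2 M, maximal_ideal M & forall i, (i < n)%N -> M <> m i.
    apply: contrapT => hM; apply: h; exists n, m; split=> // M MM.
    apply: contrapT => hi; apply: hM; exists M => // i iN e; apply: hi.
    by exists i.
  have lt k : (k < n.+1)%N -> k <> n -> (k < n)%N by lia.
  exists (fun i => if i == n then M else m i); split=> [i iN|i k iN kN].
    by case: eqP => // /(lt _ iN); apply: mP.1.
  case: eqP => [->|/(lt _ iN) i_n]; case: eqP => [->|/(lt _ kN) kn] // neq.
  - exact: nM.
  - by move/esym; apply: nM.
  - exact: mP.2.
have [m mP] := all N.
have /choice[a aP] : forall i : 'I_N, exists a, m i a /\
    forall k, (k < N)%N -> k <> i -> m k (1 - a).
  by move=> i; apply: maximal_separator.
have [i [r e]] := hN a.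
have mi := mP.1 _ (ltn_ord i).
have [_ m1 mprime] := maximal_prime mi.
have [[hi _] _] := mi.
have : m i (\prod_(k | k != i) a k).
  by rewrite -e; case: hi => _ _; apply; case: (aP i).
apply: (big_ind (fun x => ~ m i x)) => // [x y nx ny /mprime[]//|k ki mk].
apply: m1; rewrite -(subrK (a k) 1); have [_ A _] := hi; apply: A => //.
apply: (aP k).2 => //.
by move=> /val_inj ik; rewrite ik eqxx in ki.
Qed.

End IdealTheory.

Lemma noetherian_quotient (R Q : comPzRingType) (p : {rmorphism R -> Q}) :
  (forall q, exists x, p x = q) -> noetherian R -> noetherian Q.
Proof.
move=> ponto noeth I hI inc.
have [n|n x /inc //|N hN] := noeth (fun n x => I n (p x)).
  have [I0 IA IM] := hI n; split; first by rewrite rmorph0.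
    by move=> x y Ix Iy; rewrite rmorphD; apply: IA.
  by move=> r x Ix; rewrite rmorphM; apply: IM.
exists N => n nN q; have [x <-] := ponto q; exact: hN.
Qed.

(** * Dimension at most one *)

Definition jacobson (R : comPzRingType) (x : R) : Prop :=
  forall M, maximal_ideal M -> M x.

Section Jacobson.
Variable R : comPzRingType.

Lemma jacobson_ideal : is_ideal (@jacobson R).
Proof.
split=> [M [[[M0 _ _] _] _] //|x y jx jy M MM|r x jx M MM].
  by have [[[_ A _] _] _] := MM; apply: A; [apply: jx|apply: jy].
by have [[[_ _ A] _] _] := MM; apply: A; apply: jx.
Qed.

Lemma unit_or_maximal (x : R) :
  (exists y, y * x = 1) \/ exists M, maximal_ideal M /\ M x.
Proof.
have [|nx] := pselect (exists y, y * x = 1); [by left|right].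
have [|M [MM xM]] := @exists_maximal R (fun z => exists y, z = y * x).
  split; last by move=> [y e]; apply: nx; exists y.
  split; first by exists 0; rewrite mul0r.
    by move=> _ _ [u ->] [v ->]; exists (u + v); rewrite mulrDl.
  by move=> r _ [u ->]; exists (r * u); rewrite mulrA.
by exists M; split=> //; apply: xM; exists 1; rewrite mul1r.
Qed.

Lemma jacobson_unit (x : R) : jacobson x -> exists y, y * (1 - x) = 1.
Proof.
move=> jx; have [//|[M [MM Mx]]] := unit_or_maximal (1 - x).
have [[[M0 MA _] M1] _] := MM; case: M1.
by rewrite -(subrK x 1); apply: MA => //; apply: jx.
Qed.

End Jacobson.

Section OneDimensional.
Variable R : comNzRingType.
Hypothesis noeth : noetherian R.
Hypothesis dom : integral_domain R.
Variables (n0 : nat) (mx : nat -> R -> Prop).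
Hypothesis mxP : forall i, (i < n0)%N -> maximal_ideal (mx i).
Hypothesis mx_all : forall M, maximal_ideal M -> exists i, (i < n0)%N /\ M = mx i.

Let mulI (a b c : R) : a <> 0 -> b * a = c * a -> b = c.
Proof.
move=> a0 e; have [_ D] := dom.
have /D[/subr0_eq//|//] : (b - c) * a = 0 by rewrite mulrBl e subrr.
Qed.

Let pow_neq0 (b : R) k : b <> 0 -> b ^+ k <> 0.
Proof.
have [one0 D] := dom.
by move=> b0; elim: k => [|k IH]; rewrite ?expr0 // exprS => /D[].
Qed.

Lemma prime_pow (P : R -> Prop) (b : R) k : prime_ideal P -> ~ P b -> ~ P (b ^+ k).
Proof.
move=> [_ P1 PP] nb; elim: k => [|k IH]; rewrite ?expr0 // exprS.
by case/PP.
Qed.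

(** A nonmaximal prime contains none of the finitely many maximal ideals, so each of these has an
    element outside [P]; the product of such elements works. *)
Lemma jacobson_not_prime (P : R -> Prop) : prime_ideal P -> ~ maximal_ideal P ->
  exists c : R, jacobson c /\ ~ P c.
Proof.
move=> pP nmP; have [hP P1 PP] := pP.
have /choice[x xP] : forall i : 'I_n0, exists x, mx i x /\ ~ P x.
  move=> i; apply: contrapT => h; apply: nmP.
  suff -> : P = mx i by apply: mxP.
  have [_ mmax] := mxP (ltn_ord i).
  have iP x : mx i x -> P x by move=> mix; apply: contrapT => nx; apply: h; exists x.
  by apply/funext => x; apply/propext; split; [apply: mmax|apply: iP].
exists (\prod_i x i); split.
  move=> M /mx_all[i [iN ->]]; rewrite (bigD1 (Ordinal iN)) //=.
  apply: ideal_mulr; first by case: (mxP iN) => -[].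
  by case: (xP (Ordinal iN)).
by apply: (big_ind (fun x => ~ P x)) => // [u v nu nv /PP[]//|i _]; case: (xP i).
Qed.

(* With [b] outside the first [n] primes, [b] in the last one and [c] outside it, each
   of the first [n] primes contains at most one of the elements [c + b ^ t]. *)
Lemma avoid_primes n (p : nat -> R -> Prop) (b0 : R) : jacobson b0 -> b0 <> 0 ->
  (forall i, (i < n)%N -> prime_ideal (p i) /\ ~ maximal_ideal (p i)) ->
  exists b : R, [/\ jacobson b, b <> 0 & forall i, (i < n)%N -> ~ p i b].
Proof.
move=> jb0 nb0; have [J0 JA JM] := jacobson_ideal R.
elim: n => [|n IH] pP; first by exists b0; split.
have [|b [jb nb bp]] := IH; first by move=> i iN; apply: pP; apply: ltnW.
have [pnb|npb] := pselect (p n b); last first.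
  exists b; split=> // i; rewrite ltnS leq_eqVlt => /orP[/eqP -> //|]; exact: bp.
have [ppn nmn] := pP _ (ltnSn n).
have [c [jc nc]] := jacobson_not_prime ppn nmn.
pose z t := c + b ^+ t.+1.
have zn t : ~ p n (z t).
  have [hp _ _] := ppn => pz; apply: nc.
  have -> : c = z t - b ^+ t * b by rewrite /z exprSr addrK.
  by apply: ideal_sub => //; case: hp => _ _; apply.
(* A prime containing both elements contains their difference up to sign, a power of [b] times
   [1 - b ^+ (t - s)]. The latter is a unit because [b] is in the Jacobson radical. *)
have once i s t : (i < n)%N -> (s < t)%N -> p i (z s) -> ~ p i (z t).
  move=> iN st pzs pzt; have [pi _] := pP i (ltnW iN); have [hp p1 pp] := pi.
  have : p i (b ^+ s.+1 * (1 - b ^+ (t - s))).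
    have -> : b ^+ s.+1 * (1 - b ^+ (t - s)) = z s - z t.
      by rewrite mulrBr mulr1 -exprD addSn subnKC 1?ltnW // /z; ring.
    exact: ideal_sub.
  case/pp; first by apply: prime_pow => //; apply: bp.
  have [|y yu] := @jacobson_unit R (b ^+ (t - s)).
    by rewrite -subnSK // exprSr; apply: JM.
  by move=> pu; apply: p1; rewrite -yu; case: hp => _ _; apply.
have [t0 t0P] : exists t0, forall t i, (t0 <= t)%N -> (i < n)%N -> ~ p i (z t).
  have : (n <= n)%N by [].
  elim: {-2}n => [|k IHk] kn; first by exists 0%N.
  have [t0 t0P] := IHk (ltnW kn).
  have [[t pzt]|h] := pselect (exists t, p k (z t)); last first.
    exists t0 => t i t0t; rewrite ltnS leq_eqVlt => /orP[/eqP -> pz|ik].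
      by apply: h; exists t.
    exact: t0P.
  exists (maxn t0 t.+1) => t' i; rewrite geq_max => /andP[t0t' tt'].
  rewrite ltnS leq_eqVlt => /orP[/eqP ->|ik]; last exact: t0P.
  exact: (once k t t').
exists (z t0); split.
- by apply: JA => //; rewrite exprSr; apply: JM.
- by move=> z0; apply: (zn t0); rewrite z0; case: ppn => -[].
- move=> i; rewrite ltnS leq_eqVlt => /orP[/eqP -> //|iN]; exact: t0P.
Qed.

(* Krull's intersection theorem in the localization at P. *)
Lemma colon_pow_sub_prime (P : R -> Prop) (a b : R) : prime_ideal P -> P b ->
  a <> 0 -> exists k, forall r s, r * a = s * b ^+ k -> P r.
Proof.
move=> [hP P1 PP] Pb a0; have [P0 PA PM] := hP; apply: contrapT => h.
have h' k : exists r s, r * a = s * b ^+ k /\ ~ P r.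
  apply: contrapT => h1; apply: h; exists k => r s e; apply: contrapT => nr.
  by apply: h1; exists r, s.
(* [L k] is the contraction of the colon ideal [(a : b ^+ k)] of the localization at [P]. Once these
   ideals are stationary, [r * a = s * b ^+ N.+1] with [r] outside [P] gives [t * r = b * u], an
   element of [P]. *)
pose L k s := exists t u, ~ P t /\ t * s * b ^+ k = u * a.
have [k|k s [t [u [nt e]]]|N hN] := noeth (I := L).
- split; first by exists 1, 0; rewrite !(mulr0, mul0r).
    move=> s s' [t [u [nt e]]] [t' [u' [nt' e']]].
    exists (t * t'), (t' * u + t * u'); split; first by case/PP.
    have -> : t * t' * (s + s') * b ^+ k =
       t' * (t * s * b ^+ k) + t * (t' * s' * b ^+ k) by ring.
    by rewrite e e'; ring.
  move=> r s [t [u [nt e]]]; exists t, (r * u); split=> //.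
  by rewrite -[RHS]mulrA -e; ring.
- by exists t, (u * b); split=> //; rewrite exprSr mulrA e mulrAC.
have [r [s [e nr]]] := h' N.+1.
have [|t [u [nt e']]] := hN N.+1 (leqnSn _) s; first by exists 1, r; rewrite mul1r e.
have /(mulI a0) translate : t * r * a = b * u * a.
  by rewrite -[LHS]mulrA -[RHS]mulrA e -e' exprSr; ring.
have : P (t * r) by rewrite translate mulrC; apply: PM.
by case/PP.
Qed.

(* Otherwise one builds, for every [n], elements [a_i] and nonmaximal primes [p_i] such
   that [p_i] contains the colon ideal of [a_i] by the product of the other [a_k]. *)
Lemma exists_parameter N (b0 : R) :
  (forall a : 'I_N -> R, exists i r, r * a i = \prod_(k | k != i) a k) ->
  jacobson b0 -> b0 <> 0 ->
  exists b : R, [/\ jacobson b, b <> 0 & forall P, prime_ideal P -> P b -> maximal_ideal P].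
Proof.
move=> hN jb0 nb0; apply: contrapT => h.
have bad (b : R) : jacobson b -> b <> 0 ->
    exists P, [/\ prime_ideal P, P b & ~ maximal_ideal P].
  move=> jb nb; apply: contrapT => h1; apply: h; exists b; split=> // P pP Pb.
  by apply: contrapT => nP; apply: h1; exists P.
have [one0 D] := dom.
have build n : exists (a : nat -> R) (p : nat -> R -> Prop), forall i, (i < n)%N ->
    [/\ a i <> 0, prime_ideal (p i), ~ maximal_ideal (p i) &
      forall r s, r * \prod_(k < n | k != i :> nat) a k = s * a i -> p i r].
  elim: n => [|n [a [p ap]]]; first by exists (fun _ => 0), (fun _ _ => True).
  have [|b [jb nb bp]] := @avoid_primes n p b0 jb0 nb0.
    by move=> i /ap[].
  have [P [pP Pb nmP]] := bad b jb nb.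
  have prod0 : \prod_(k < n) a k <> 0.
    by apply: (big_ind (fun x => x <> 0)) => // [x y nx ny /D[]//|k _]; case: (ap k).
  (* The new element is [b ^+ k]. Since [b] avoids the earlier primes, multiplying the earlier
     products by [b ^+ k] keeps their colon conditions. *)
  have [k kP] := colon_pow_sub_prime pP Pb prod0.
  exists (fun i => if i == n then b ^+ k else a i), (fun i => if i == n then P else p i).
  move=> i; rewrite ltnS leq_eqVlt big_mkcond big_ord_recr /= eqxx -big_mkcond /=.
  have E Q : \prod_(i0 < n | Q i0) (if i0 == n :> nat then b ^+ k else a i0) =
      \prod_(i0 < n | Q i0) a i0 by apply: eq_bigr => l _; rewrite ltn_eqF.
  rewrite E eq_sym; have [<-|ni] /= := eqVneq n i.
    move=> _; split=> // [|r s]; first exact: pow_neq0.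
    rewrite mulr1 (eq_bigl xpredT) => [|l]; last by rewrite neq_ltn ltn_ord.
    exact: kP.
  move=> iN.
  have [ai pi nmi ri] := ap i iN; split=> // r s; rewrite mulrA => e.
  have [_ _ pp] := pi.
  have /pp[//|] : p i (r * b ^+ k) by apply: (ri _ s); rewrite mulrAC.
  by move/(prime_pow pi (bp _ iN)).
have [a [p ap]] := build N.
have [i [r e]] := hN (fun i => a i).
have [_ [_ p1 _] _ pr] := ap i (ltn_ord i).
by apply: p1; apply: (pr 1 r); rewrite mul1r e.
Qed.

End OneDimensional.

(** * Lengths of submodules of a field *)

Section Submodules.
Variables (R : comNzRingType) (K : fieldType) (f : {rmorphism R -> K}).
Hypothesis f_inj : injective f.
Implicit Types (M N P : K -> Prop) (I : R -> Prop).

Definition submod M := [/\ M 0, (forall x y, M x -> M y -> M (x + y)) &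
  forall r x, M x -> M (f r * x)].

Definition incl M N := forall x, M x -> N x.

Definition msum M N : K -> Prop := fun x => exists u v, [/\ M u, N v & x = u + v].
Definition mcap M N : K -> Prop := fun x => M x /\ N x.
Definition scale (c : K) M : K -> Prop := fun x => exists y, M y /\ x = c * y.
Definition ideal_image I : K -> Prop := fun x => exists r, I r /\ x = f r.
Definition ring_image : K -> Prop := ideal_image (fun _ => True).

(* Every strict chain of submodules from [N] to [M] has at most [e] steps. *)
Fixpoint len_le (e : nat) N M : Prop :=
  match e with
  | 0%N => incl M N
  | e'.+1 => forall N', submod N' -> incl N N' -> incl N' M ->
               (exists x, N' x /\ ~ N x) -> len_le e' N' M
  end.

Lemma submodN M x : submod M -> M x -> M (- x).
Proof. by move=> [_ _ MZ] Mx; rewrite -mulN1r -(rmorphN1 f); apply: MZ. Qed.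

Lemma submodB M x y : submod M -> M x -> M y -> M (x - y).
Proof. by move=> hM Mx My; case: (hM) => _ MA _; apply: MA => //; apply: submodN. Qed.

Lemma submod_sum M n (F : 'I_n -> K) : submod M -> (forall i, M (F i)) -> M (\sum_i F i).
Proof. by move=> [M0 MA _] h; elim/big_ind: _. Qed.

Lemma msumP M N : submod M -> submod N -> submod (msum M N).
Proof.
move=> [M0 MA MM] [N0 NA NM]; split.
- by exists 0, 0; rewrite addr0.
- move=> _ _ [u [v [Mu Nv ->]]] [u' [v' [Mu' Nv' ->]]].
  by exists (u + u'), (v + v'); rewrite addrACA; split; [apply: MA|apply: NA|].
- move=> r _ [u [v [Mu Nv ->]]]; exists (f r * u), (f r * v); rewrite mulrDr.
  by split; [apply: MM|apply: NM|].
Qed.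

Lemma mcapP M N : submod M -> submod N -> submod (mcap M N).
Proof.
move=> [M0 MA MM] [N0 NA NM]; split=> // [x y [Mx Nx] [My Ny]|r x [Mx Nx]].
  by split; [apply: MA|apply: NA].
by split; [apply: MM|apply: NM].
Qed.

Lemma scaleP c M : submod M -> submod (scale c M).
Proof.
move=> [M0 MA MM]; split; first by exists 0; rewrite mulr0.
  by move=> _ _ [x [Mx ->]] [y [My ->]]; exists (x + y); rewrite mulrDr; split=> //; apply: MA.
by move=> r _ [x [Mx ->]]; exists (f r * x); rewrite mulrCA; split=> //; apply: MM.
Qed.

Lemma ideal_imageP I : is_ideal I -> submod (ideal_image I).
Proof.
move=> [I0 IA IM]; split; first by exists 0; rewrite rmorph0.
  move=> _ _ [x [Ix ->]] [y [Iy ->]]; exists (x + y).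
  by rewrite rmorphD; split=> //; apply: IA.
by move=> r _ [x [Ix ->]]; exists (r * x); rewrite rmorphM; split=> //; apply: IM.
Qed.

Lemma ring_imageP : submod ring_image.
Proof. exact: ideal_imageP. Qed.

Lemma msum_l M N : submod N -> incl M (msum M N).
Proof. by move=> [N0 _ _] x Mx; exists x, 0; rewrite addr0. Qed.

Lemma msum_r M N : submod M -> incl N (msum M N).
Proof. by move=> [M0 _ _] x Nx; exists 0, x; rewrite add0r. Qed.

Lemma msumS M N P : incl M N -> incl (msum M P) (msum N P).
Proof. by move=> MN _ [u [v [Mu Pv ->]]]; exists u, v; split=> //; apply: MN. Qed.

Lemma msum_sub M N P : submod P -> incl M P -> incl N P -> incl (msum M N) P.
Proof. by move=> [_ PA _] MP NP _ [u [v [/MP Mu /NP Nv ->]]]; apply: PA. Qed.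

Lemma scale_sub c M N : incl M N -> incl (scale c M) (scale c N).
Proof. by move=> MN _ [y [/MN Ny ->]]; exists y. Qed.

Lemma scaleK c M : c != 0 -> scale c^-1 (scale c M) = M.
Proof.
move=> c0; apply/funext => x; apply/propext; split.
  by move=> [_ [[z [Mz ->]] ->]]; rewrite mulKf.
by move=> Mx; exists (c * x); rewrite mulKf //; split=> //; exists x.
Qed.

Lemma scaleC c d M : scale c (scale d M) = scale d (scale c M).
Proof.
apply/funext => x; apply/propext; split=> -[_ [[z [Mz ->]] ->]].
  by exists (c * z); split; [exists z|rewrite mulrCA].
by exists (d * z); split; [exists z|rewrite mulrCA].
Qed.

Lemma len_le_sub e N N' M : incl N N' -> len_le e N M -> len_le e N' M.
Proof.
case: e => [|e] NN' /=; first by move=> MN x /MN /NN'.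
move=> h N1 sN1 N'N1 N1M [x [N1x nx]]; apply: h => //.
  by move=> y /NN' /N'N1.
by exists x; split=> // /NN'.
Qed.

(** Additivity of length, with [(N + P) / N] replaced by the isomorphic [P / (N :&: P)]. By the
    modular law, a strict step above [N] stays strict after adding [P] or after intersecting with
    [P]. *)
Lemma len_le_add e g N P M : submod N -> submod P -> submod M -> incl N M -> incl P M ->
  len_le e (msum N P) M -> len_le g (mcap N P) P -> len_le (e + g) N M.
Proof.
move=> sN sP sM NM PM; move Ek : (e + g)%N => k.
elim: k e g Ek N sN NM => [|k IH] e g Ek N sN NM.
  have [-> ->] /= : e = 0%N /\ g = 0%N by lia.
  move=> h1 h2 x /h1[u [v [Nu Pv ->]]]; have [Nv _] := h2 _ Pv.
  by case: sN => _ NA _; apply: NA.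
move=> h1 h2 /= N' sN' NN' N'M [x [N'x nNx]].
have [[y [N'y nNy]]|nex] := pselect (exists y, msum N' P y /\ ~ msum N P y).
  case: e Ek h1 => [|e] Ek h1.
    by case: nNy; apply: h1; apply: msum_sub N'y.
  apply: (IH e g) => //; first by lia.
    apply: h1; [exact: msumP|exact: msumS|exact: msum_sub|].
    by exists y.
  by apply: len_le_sub h2 => z [Nz Pz]; split=> //; apply: NN'.
case: g Ek h2 => [|g] Ek h2.
  case: nNx; have [u [v [Nu Pv ->]]] : msum N P x.
    by apply: contrapT => nx; apply: nex; exists x; split=> //; apply: msum_l.
  by have [Nv _] := h2 _ Pv; case: sN => _ NA _; apply: NA.
apply: (IH e g) => //; first by lia.
  by apply: len_le_sub h1; apply: msumS.
apply: h2; [exact: mcapP| |by move=> z []|].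
  by move=> z [Nz Pz]; split=> //; apply: NN'.
have [u [v [Nu Pv xE]]] : msum N P x.
  by apply: contrapT => nx; apply: nex; exists x; split=> //; apply: msum_l.
have vE : v = x - u by rewrite xE addrC addKr.
exists v; split.
  by split=> //; rewrite vE; apply: submodB => //; apply: NN'.
by move=> [Nv _]; apply: nNx; rewrite xE; case: sN => _ NA _; apply: NA.
Qed.

Lemma len_le_scale e c N M : c != 0 -> len_le e N M -> len_le e (scale c N) (scale c M).
Proof.
move=> c0; elim: e N => [|e IH] N /=.
  by move=> MN; apply: scale_sub.
move=> h N' sN' NN' N'M [x [N'x nNx]].
have cV : c^-1 != 0 by rewrite invr_eq0.
rewrite -(scaleK N' cV) invrK; apply: IH; apply: h.
- exact: scaleP.
- by rewrite -(scaleK N c0); apply: scale_sub.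
- by rewrite -(scaleK M c0); apply: scale_sub.
exists (c^-1 * x); split; first by exists x.
by move=> Nx; apply: nNx; exists (c^-1 * x); rewrite mulVKf.
Qed.

Lemma len_le_chain e n (C : nat -> K -> Prop) M : len_le e (C 0%N) M ->
  (forall i, submod (C i)) -> (forall i, (i < n)%N -> incl (C i) (C i.+1)) ->
  (forall i, (i < n)%N -> exists x, C i.+1 x /\ ~ C i x) ->
  (forall i, (i <= n)%N -> incl (C i) M) -> (n <= e)%N.
Proof.
elim: e n C => [|e IH] [|n] C //= h sC CC Cx CM.
  have [x [Cx1 nx]] := Cx 0%N isT; case: nx; apply: h; exact: (CM 1%N).
rewrite ltnS; apply: (IH n (fun i => C i.+1)) => [|i|i iN|i iN|i iN].
- by apply: h => //; [apply: CC|apply: CM|apply: Cx].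
- exact: sC.
- exact: CC.
- exact: Cx.
- exact: CM.
Qed.

(** Subtraction of lengths: when [g] is the least bound for [P / M], a chain from [N] to [M] can be
    prolonged by at least [g] steps up to [P]. *)
Lemma len_le_cut e g N M P : submod M -> incl N M -> incl M P ->
  len_le (e + g) N P -> (forall g', (g' < g)%N -> ~ len_le g' M P) -> len_le e N M.
Proof.
move=> sM + MP + mg; elim: e N => [|e IH] N NM.
  rewrite add0n; case: g mg => [|g] mg h x Mx; first by apply: h; apply: MP.
  apply: contrapT => nNx; apply: (mg g) => //; apply: h => //.
  by exists x.
by move=> h N' sN' NN' N'M ex; apply: IH => //; apply: h => // x /N'M /MP.
Qed.

Definition gen_span n (g : nat -> K) : K -> Prop :=
  fun x => exists c : nat -> R, x = \sum_(i < n) f (c i) * g i.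

Lemma gen_spanP n g : submod (gen_span n g).
Proof.
split.
- by exists (fun _ => 0); rewrite big1 // => i _; rewrite rmorph0 mul0r.
- move=> _ _ [c ->] [d ->]; exists (fun i => c i + d i).
  by rewrite -big_split; apply: eq_bigr => i _; rewrite rmorphD mulrDl.
- move=> r _ [c ->]; exists (fun i => r * c i).
  by rewrite mulr_sumr; apply: eq_bigr => i _; rewrite rmorphM mulrA.
Qed.

Lemma gen_span_gen n g i : (i < n)%N -> gen_span n g (g i).
Proof.
move=> iN; exists (fun k => (k == i)%:R).
rewrite (bigD1 (Ordinal iN)) //= eqxx rmorph1 mul1r big1 ?addr0 // => k ki.
by rewrite -val_eqE /= in ki; rewrite (negbTE ki) rmorph0 mul0r.
Qed.

Lemma gen_span_sub n g M : submod M -> (forall i, (i < n)%N -> M (g i)) ->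
  incl (gen_span n g) M.
Proof.
move=> sM h _ [c ->]; apply: submod_sum => // i; have [_ _ MM] := sM.
by apply: MM; apply: h.
Qed.

Definition jac_span n (g : nat -> K) : K -> Prop :=
  fun x => exists c : nat -> R, (forall i, jacobson (c i)) /\
    x = \sum_(i < n) f (c i) * g i.

(** Generators are eliminated one at a time: in the relation for [g n], the coefficient [1 - c n] is
    a unit, so [g n] is expressed through [N] and the earlier generators. *)
Lemma nakayama n g N : submod N -> incl (gen_span n g) (msum N (jac_span n g)) ->
  incl (gen_span n g) N.
Proof.
move=> sN h; apply: gen_span_sub => //.
have {h} : forall i, (i < n)%N -> msum N (jac_span n g) (g i).
  by move=> i iN; apply: h; apply: gen_span_gen.
have [J0 JA JM] := jacobson_ideal R; have [N0 NA NM] := sN.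
elim: n => [|n IH] h //.
have [u [_ [Nu [c [jc ->]] eq_gn]]] := h n (ltnSn n).
have [w wE] := jacobson_unit (jc n).
have gnE : g n = f w * u + \sum_(k < n) f (w * c k) * g k.
  have e : (1 - f (c n)) * g n = u + \sum_(k < n) f (c k) * g k.
    by rewrite mulrBl mul1r {1}eq_gn big_ord_recr /= addrA addrK.
  have <- : f w * ((1 - f (c n)) * g n) = g n.
    by rewrite mulrA -(rmorph1 f) -rmorphB -rmorphM wE rmorph1 mul1r.
  rewrite e mulrDr mulr_sumr; congr (_ + _).
  by apply: eq_bigr => k _; rewrite rmorphM mulrA.
have H i : (i < n)%N -> N (g i).
  apply: IH => {}i iN.
  have [v [_ [Nv [d [jd ->]] eq_gi]]] := h i (ltnW iN).
  exists (v + f (d n * w) * u), (\sum_(k < n) f (d k + d n * (w * c k)) * g k); split.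
  - by apply: NA => //; apply: NM.
  - exists (fun k => d k + d n * (w * c k)); split=> // k.
    by apply: JA => //; apply: (JM); apply: JM.
  rewrite eq_gi big_ord_recr /= gnE mulrDr mulrA -rmorphM mulr_sumr.
  rewrite [\sum_(k < n) f (d k + _) * _](eq_bigr (fun k : 'I_n =>
     f (d k) * g k + f (d n) * (f (w * c k) * g k))); last first.
    by move=> k _; rewrite rmorphD rmorphM mulrDl mulrA.
  by rewrite big_split /=; ring.
move=> i; rewrite ltnS leq_eqVlt => /orP[/eqP ->|]; last exact: H.
rewrite gnE; apply: NA; first exact: NM.
by apply: submod_sum => // k; apply: NM; apply: H.
Qed.

End Submodules.

(** * Finite colength and Krull's principal ideal theorem *)

Section FiniteColength.
Variables (R : comNzRingType) (K : fieldType) (f : {rmorphism R -> K}).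
Hypothesis f_inj : injective f.
Hypothesis noeth : noetherian R.
Let top := ring_image f.

Let f0 (c : R) : c <> 0 -> f c != 0.
Proof. by move=> c0; apply/eqP => e; apply: c0; apply: f_inj; rewrite e rmorph0. Qed.

Let mulI (a b c : R) : a <> 0 -> b * a = c * a -> b = c.
Proof.
move=> /f0 a0 e; apply: f_inj; apply: (mulIf a0).
by rewrite -!rmorphM e.
Qed.

Let sub_top (I : R -> Prop) : incl (ideal_image f I) top.
Proof. by move=> _ [r [_ ->]]; exists r. Qed.

Lemma ideal_preimage N : submod f N -> is_ideal (fun r => N (f r)).
Proof.
move=> [N0 NA NM]; split; first by rewrite rmorph0.
  by move=> x y Nx Ny; rewrite rmorphD; apply: NA.
by move=> r x Nx; rewrite rmorphM; apply: NM.
Qed.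

Lemma scale_ring_image (c : R) x : scale (f c) top x <-> exists r, x = f (r * c).
Proof.
split=> [[_ [[r [_ ->]] ->]]|[r ->]]; first by exists r; rewrite rmorphM mulrC.
by exists (f r); split; [exists r|rewrite rmorphM mulrC].
Qed.

(** A prime containing [b] is maximal, hence of colength at most one. If [c * d] is in [I],
    multiplication by [c] maps [I + (d)] into [I], so the colengths of [I + (c)] and [I + (d)] add
    up to a bound for that of [I]. *)
Lemma colength_of_ideal (b : R) : (forall P, prime_ideal P -> P b -> maximal_ideal P) ->
  forall I, is_ideal I -> I b -> exists e, len_le f e (ideal_image f I) top.
Proof.
move=> pb; apply: noeth_prime_ind => // [I hI I1 _|P pP Pb|I c d hI Icd].
- by exists 0%N => _ [r [_ ->]]; exists r; split=> //; apply: ideal_eq1.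
- exists 1%N => N sN PN Ntop [x [Nx nPx]].
  have [[hP _] Pmax] := pb P pP Pb.
  have hJ := ideal_preimage sN.
  have [J1|nJ1] := pselect (N (f 1)).
    by move=> _ [r [_ ->]]; exact: (ideal_eq1 r hJ J1).
  case: nPx; have [r [_ xr]] := Ntop _ Nx; exists r; split=> //.
  apply: (Pmax _ (conj hJ nJ1)); last by rewrite -xr.
  by move=> y Py; apply: PN; exists y.
move=> Qc Qd Ib; have [|e1 h1] := Qc; first exact: ideal_adjoinS.
have [|e2 h2] := Qd; first exact: ideal_adjoinS.
have sP : submod f (scale (f c) top) by apply/scaleP/ring_imageP.
have Pt : incl (scale (f c) top) top.
  by move=> _ /scale_ring_image[r ->]; exists (r * c).
exists (e1 + e2)%N; apply: (@len_le_add _ _ f e1 e2 _ (scale (f c) top)) => //.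
- exact: ideal_imageP.
- exact: ring_imageP.
- apply: len_le_sub h1 => _ [_ [[u [r [Iu ->]]] ->]].
  exists (f u), (f (r * c)); rewrite rmorphD; split=> //; first by exists u.
  by apply/scale_ring_image; exists r.
have [c0|c0] := pselect (c = 0).
  have e0 : incl (scale (f c) top) (mcap (ideal_image f I) (scale (f c) top)).
    move=> _ /scale_ring_image[r ->]; split; last by apply/scale_ring_image; exists r.
    by rewrite c0 mulr0; exists 0; split=> //; case: hI.
  case: (e2) => [|e] //= N' _ NN' N'M [x [N'x nx]]; case: nx.
  by apply: e0; apply: N'M.
apply: len_le_sub (len_le_scale (f0 c0) h2) => _ [_ [[_ [[u [r [Iu ->]]] ->]] ->]].
split; last by exists (f (u + r * d)); split=> //; exists (u + r * d).
exists (c * (u + r * d)); rewrite rmorphM; split=> //.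
have -> : c * (u + r * d) = c * u + r * (c * d) by ring.
by have [_ IA IM] := hI; apply: IA; apply: IM.
Qed.

Section DimensionOne.
Variable b : R.
Hypothesis jb : jacobson b.
Hypothesis pb : forall P, prime_ideal P -> P b -> maximal_ideal P.

Lemma principal_ideal (c : R) : is_ideal (fun x => exists r, x = r * c).
Proof.
split; first by exists 0; rewrite mul0r.
  by move=> _ _ [r ->] [s ->]; exists (r + s); rewrite mulrDl.
by move=> r _ [s ->]; exists (r * s); rewrite mulrA.
Qed.

(* The argument of Krull's principal ideal theorem, with the symbolic powers of a
   prime replaced by the contractions of the powers of a principal ideal. *)
Lemma nonzero_prime_maximal (P : R -> Prop) a :
  prime_ideal P -> P a -> a <> 0 -> maximal_ideal P.
Proof.
move=> pP Pa a0; have [hP P1 PP] := pP.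
have [/(pb pP) //|nb] := pselect (P b).
(* [A n] is the contraction to [R] of the ideal generated by [a ^+ n] in the localization at [P]. *)
pose A n : K -> Prop := ideal_image f (fun r => exists t s, ~ P t /\ t * r = s * a ^+ n).
have hA n : is_ideal (fun r => exists t s, ~ P t /\ t * r = s * a ^+ n).
  split; first by exists 1, 0; rewrite mulr0 mul0r.
    move=> x y [t [s [nt e]]] [t' [s' [nt' e']]].
    exists (t * t'), (t' * s + t * s'); split; first by case/PP.
    have -> : t * t' * (x + y) = t' * (t * x) + t * (t' * y) by ring.
    by rewrite e e'; ring.
  move=> r x [t [s [nt e]]]; exists t, (r * s); split=> //.
  by rewrite -[RHS]mulrA -e; ring.
have Adec n : incl (A n.+1) (A n).
  move=> _ [r [[t [s [nt e]]] ->]]; exists r; split=> //.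
  by exists t, (s * a); rewrite e exprS mulrA.
pose bt := scale (f b) top.
have sbt : submod f bt by apply/scaleP/ring_imageP.
have [e He] := colength_of_ideal pb (principal_ideal b) (ex_intro _ 1 (esym (mul1r b))).
have btE : incl (ideal_image f (fun x => exists r, x = r * b)) bt.
  by move=> _ [_ [[r ->] ->]]; apply/scale_ring_image; exists r.
(* The decreasing sequence [A n + bR] cannot have [e.+1] strict steps above [bR]; the chain [C]
   lists it in increasing order. *)
have [n An] : exists n, incl (A n) (msum (A n.+1) bt).
  apply: contrapT => nA.
  pose C i := msum (A (e.+1 - i)%N) bt.
  have CT i : incl (C i) top.
    apply: msum_sub; [exact: ring_imageP|exact: sub_top|].
    by move=> _ /scale_ring_image[r ->]; exists (r * b).
  suff : (e.+1 <= e)%N by rewrite ltnn.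
  apply: (@len_le_chain _ _ f e e.+1 C top) => //.
  - apply: len_le_sub He => x /btE; apply: msum_r; exact: ideal_imageP.
  - by move=> i; apply: msumP => //; apply: ideal_imageP.
  - by move=> i iN; apply: msumS; rewrite subSn //; apply: Adec.
  move=> i iN; apply: contrapT => h; apply: nA; exists (e - i)%N => x Ax.
  apply: contrapT => nx; apply: h; exists x; split.
    by rewrite /C subSS; apply: (msum_l sbt).
  by rewrite /C subSn.
have [m [g gP]] := noeth_fg noeth (hA n).
have spanA : gen_span f m (fun i => f (g i)) = A n.
  apply/funext => x; apply/propext; split.
    move=> [c ->]; exists (\sum_(i < m) c i * g i); split; first by apply/gP; exists c.
    by rewrite rmorph_sum; apply: eq_bigr => i _; rewrite rmorphM.
  move=> [r [/gP[c ->] ->]]; exists c.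
  by rewrite rmorph_sum; apply: eq_bigr => i _; rewrite rmorphM.
(* If [x = u + r * b] with [x] in [A n] and [u] in [A n.+1], then [r] is in [A n] because [b] is
   outside [P]. Hence [A n = A n.+1 + b A n], and Nakayama's lemma applies. *)
have : incl (A n) (A n.+1).
  rewrite -spanA; apply: nakayama; first exact: ideal_imageP.
  rewrite spanA => x Ax; have [u [_ [Au /scale_ring_image[r ->] xE]]] := An x Ax.
  have [x' [Ax' xx']] := Ax; have [u' [Au' uu']] := Au.
  have Ar : exists t s, ~ P t /\ t * r = s * a ^+ n.
    have [t [s [nt e1]]] := Ax'; have [t' [s' [nt' e2]]] := Au'.
    have rb : r * b = x' - u'.
      by apply: f_inj; rewrite rmorphB -xx' -uu' xE addrC addKr.
    exists (t * t' * b), (t' * s - t * s' * a); split.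
      by case/PP => // /PP[].
    have -> : t * t' * b * r = t * t' * (r * b) by ring.
    have -> : t * t' * (r * b) = t' * (t * x') - t * (t' * u') by rewrite rb; ring.
    by rewrite e1 e2 exprS; ring.
  exists u, (f (r * b)); split=> //.
  have /gP[c rE] := Ar; exists (fun i => c i * b); split=> [i|].
    by have [_ _] := jacobson_ideal R; apply.
  rewrite rE mulr_suml rmorph_sum; apply: eq_bigr => i _.
  by rewrite -rmorphM; congr (f _); ring.
(* Now [t * a ^+ n = s * a ^+ n.+1] for some [t] outside [P], and cancelling gives [t = s * a], an
   element of [P]. *)
move=> /(_ (f (a ^+ n)))[|r [[t [s [nt e1]]] /f_inj re]].
  by exists (a ^+ n); split=> //; exists 1, 1.
case: nt; have an0 : a ^+ n <> 0.
  by elim: (n) => [|k IH]; [rewrite expr0; apply/eqP; apply: oner_neq0|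
    rewrite exprS => h; apply: IH; apply: (mulI a0); rewrite mul0r mulrC].
suff -> : t = s * a by case: hP => _ _; apply.
by apply: (mulI an0); rewrite -mulrA -exprS -e1 re.
Qed.

Lemma finite_colength (c : R) : c <> 0 -> exists e, len_le f e (scale (f c) top) top.
Proof.
move=> c0; have [P pP Pc|e he] := colength_of_ideal (b := c) _ (principal_ideal c)
   (ex_intro _ 1 (esym (mul1r c))).
  exact: nonzero_prime_maximal pP Pc c0.
exists e; apply: len_le_sub he => _ [_ [[r ->] ->]].
by apply/scale_ring_image; exists r.
Qed.

(* Compare the lengths along [cM <= M <= T] and [cM <= cT <= T], where [T = d^-1 R]. *)
Lemma len_le_fractional (c d : R) e M : c <> 0 -> d <> 0 -> submod f M ->
  (forall x, M x -> exists r, f d * x = f r) ->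
  len_le f e (scale (f c) top) top -> len_le f e (scale (f c) M) M.
Proof.
move=> c0 d0 sM Md he.
have fd := f0 d0; have fdV : (f d)^-1 != 0 by rewrite invr_eq0.
have cM : incl (scale (f c) M) M.
  by move=> _ [x [Mx ->]]; have [_ _ MM] := sM; apply: MM.
have [[x [Mx x0]]|M0] := pselect (exists x, M x /\ x <> 0); last first.
  have M0' x : M x -> x = 0 by move=> Mx; apply: contrapT => nx; apply: M0; exists x.
  case: (e) => [|e'] /=.
    by move=> x Mx; exists 0; rewrite mulr0 (M0' _ Mx); split=> //; case: sM.
  move=> N' _ NN' N'M [x [N'x nx]]; case: nx.
  exists 0; rewrite mulr0 (M0' _ (N'M _ N'x)); split=> //; case: sM => //.
pose T := scale (f d)^-1 top.
have sT : submod f T by apply/scaleP/ring_imageP.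
have MT : incl M T.
  by move=> y /[dup] My /Md[r e1]; exists (f r); split; [exists r|rewrite -e1 mulKf].
have heT : len_le f e (scale (f c) T) T.
  by rewrite /T scaleC; apply: len_le_scale.
have [r rE] := Md x Mx.
have r0 : r <> 0.
  by move=> r0; move/eqP: rE; rewrite r0 rmorph0 mulf_eq0 (negbTE fd) /= => /eqP.
(* [d M] contains [r R] with [r] nonzero, so [T / M] has finite length; its least bound [g] is then
   cancelled by [len_le_cut]. *)
have [g0 hg0] : exists g, len_le f g M T.
  have [g hg] := finite_colength r0; exists g.
  rewrite -(scaleK M fd); apply: len_le_scale => //.
  apply: len_le_sub hg => _ /scale_ring_image[s ->].
  exists (f s * x); split; first by have [_ _] := sM; apply.
  by rewrite mulrCA rE rmorphM.
have [g [hg gmin]] : exists g, len_le f g M T /\ forall g', (g' < g)%N -> ~ len_le f g' M T.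
  have ex : exists g, `[< len_le f g M T >] by exists g0; apply/asboolP.
  exists (ex_minn ex); case: ex_minnP => g /asboolP hg gmin; split=> // g' lt h.
  by have := gmin g'; rewrite asboolT // => /(_ isT); rewrite leqNgt lt.
apply: (@len_le_cut _ _ f e g _ _ T) => //.
have cTT : incl (scale (f c) T) T.
  by move=> _ [y [Ty ->]]; have [_ _] := sT; apply.
apply: (@len_le_add _ _ f e g _ (scale (f c) T) T) => //.
- exact: scaleP.
- exact: scaleP.
- by move=> y /cM /MT.
- by apply: len_le_sub heT; apply: (msum_r (scaleP _ sM)).
apply: len_le_sub (len_le_scale (f0 c0) hg) => y cy; split=> //.
exact: scale_sub cy.
Qed.

End DimensionOne.

End FiniteColength.

(** * Integral elements *)

Section Integral.
Variables (R : comNzRingType) (K : fieldType) (f : {rmorphism R -> K}).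
Hypothesis f_inj : injective f.
Hypothesis fracK : forall x, exists a b, f b != 0 /\ x = f a / f b.
Let top := ring_image f.

Lemma common_denominator n (g : nat -> K) :
  exists d, d <> 0 /\ forall z, gen_span f n g z -> exists r, f d * z = f r.
Proof.
elim: n => [|n [d [d0 IH]]].
  exists 1; split; first by apply/eqP; apply: oner_neq0.
  by move=> z [c ->]; exists 0; rewrite big_ord0 mulr0 rmorph0.
have [u [v [v0 gE]]] := fracK (g n).
have fd : f d != 0.
  by apply/eqP => e; apply: d0; apply: f_inj; rewrite e rmorph0.
exists (d * v); split.
  by move=> e; have := mulf_neq0 fd v0; rewrite -rmorphM e rmorph0 eqxx.
move=> _ [c ->]; rewrite big_ord_recr /= gE mulrDr.
have [|r rE] := IH (\sum_(i < n) f (c i) * g i); first by exists c.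
exists (v * r + d * c n * u); rewrite rmorphD; congr (_ + _).
  by rewrite !rmorphM mulrAC rE mulrC.
by rewrite !rmorphM; field.
Qed.

Lemma jac_span_submod n (g : nat -> K) : submod f (jac_span f n g).
Proof.
have [J0 JA JM] := jacobson_ideal R; split.
- exists (fun _ => 0); split=> //.
  by rewrite big1 // => i _; rewrite rmorph0 mul0r.
- move=> _ _ [c [jc ->]] [d [jd ->]]; exists (fun i => c i + d i); split.
    by move=> i; apply: JA.
  by rewrite -big_split; apply: eq_bigr => i _; rewrite rmorphD mulrDl.
- move=> r _ [c [jc ->]]; exists (fun i => r * c i); split.
    by move=> i; apply: JM.
  by rewrite mulr_sumr; apply: eq_bigr => i _; rewrite rmorphM mulrA.
Qed.

Lemma jac_span_mul n (g : nat -> K) c z :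
  jacobson c -> gen_span f n g z -> jac_span f n g (f c * z).
Proof.
have [J0 JA JM] := jacobson_ideal R; move=> jc [d ->]; exists (fun i => d i * c).
split=> [i|]; first exact: JM.
by rewrite mulr_sumr; apply: eq_bigr => i _; rewrite rmorphM mulrA [f c * _]mulrC.
Qed.

Lemma jac_span_sub n (g : nat -> K) : incl (jac_span f n g) (gen_span f n g).
Proof. by move=> _ [c [_ ->]]; exists c. Qed.

Lemma gen_span_mono n m (g : nat -> K) : (n <= m)%N -> incl (gen_span f n g) (gen_span f m g).
Proof.
move=> nm; apply: gen_span_sub; first exact: gen_spanP.
by move=> i iN; apply: gen_span_gen; apply: leq_trans nm.
Qed.

Lemma integral_of_pow n (x : K) (g : nat -> K) :
  (forall k, (k < n)%N -> integralOver f (g k)) ->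
  x ^+ n = \sum_(k < n) g k * x ^+ k -> integralOver f x.
Proof.
move=> gi e; pose p := 'X^n - \poly_(k < n) g k.
have sp : (size (- \poly_(k < n) g k)%R < size ('X^n : {poly K}))%N.
  by rewrite size_polyN size_polyXn ltnS size_poly.
have pm : p \is monic.
  by rewrite monicE lead_coefDl // lead_coefXn.
apply: (integral_root_monic pm).
  by rewrite /root hornerD hornerN hornerXn horner_poly e subrr.
apply/integral_poly => i; rewrite coefB coefXn coef_poly.
apply: integral_sub; first exact: integral_nat.
by case: ifP => [/gi|_] //; apply: integral0.
Qed.

Definition peval (x : K) (p : {poly R}) : K := (map_poly f p).[x].

Lemma pevalE x p : peval x p = \sum_(k < size p) f p`_k * x ^+ k.
Proof.
rewrite /peval horner_coef size_map_inj_poly ?rmorph0 //.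
by apply: eq_bigr => k _; rewrite coef_map.
Qed.

Lemma pevalM x p q : peval x (p * q) = peval x p * peval x q.
Proof. by rewrite /peval rmorphM hornerM. Qed.

Lemma pevalD x p q : peval x (p + q) = peval x p + peval x q.
Proof. by rewrite /peval rmorphD hornerD. Qed.

Lemma pevalC x c : peval x c%:P = f c.
Proof. by rewrite /peval map_polyC hornerC. Qed.

Lemma pevalX x : peval x 'X = x.
Proof. by rewrite /peval map_polyX hornerX. Qed.

Lemma pevalXn x n : peval x 'X^n = x ^+ n.
Proof. by rewrite /peval map_polyXn hornerXn. Qed.

Lemma peval_sum x m (F : 'I_m -> {poly R}) :
  peval x (\sum_i F i) = \sum_i peval x (F i).
Proof. by apply: (big_morph _ (pevalD x)); rewrite /peval rmorph0 horner0. Qed.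

Lemma integral_pow x : integralOver f x -> exists n (c : nat -> R),
  x ^+ n = \sum_(k < n) f (c k) * x ^+ k.
Proof.
move=> [p pm /eqP]; rewrite -/(peval x p) pevalE.
have sp : (0 < size p)%N by rewrite size_poly_gt0 monic_neq0.
move: pm; rewrite monicE /lead_coef => /eqP pm.
rewrite -(prednK sp) big_ord_recr /= pm rmorph1 mul1r => /eqP.
rewrite addrC addr_eq0 => /eqP xp.
exists (size p).-1, (fun k => - p`_k); rewrite xp -sumrN.
by apply: eq_bigr => k _; rewrite rmorphN mulNr.
Qed.

Lemma integral_span x : integralOver f x ->
  exists n, forall z, gen_span f n (fun k => x ^+ k) z <-> exists p, z = peval x p.
Proof.
move=> /integral_pow[n [c xn]]; exists n => z.
have [M0 MA MM] := gen_spanP f n (fun k => x ^+ k).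
have xk k : gen_span f n (fun k => x ^+ k) (x ^+ k).
  elim/ltn_ind: k => k IH; have [kn|nk] := ltnP k n.
    exact: (@gen_span_gen _ _ _ n (fun k => x ^+ k)).
  rewrite -(subnK nk) exprD xn mulr_sumr; apply: submod_sum; first exact: gen_spanP.
  move=> i; rewrite mulrCA -exprD; apply: (MM); apply: IH.
  by have := ltn_ord i; lia.
split=> [[d ->]|[p ->]].
  exists (\sum_(i < n) (d i)%:P * 'X^i); rewrite peval_sum.
  by apply: eq_bigr => i _; rewrite pevalM pevalC pevalXn.
rewrite pevalE; apply: submod_sum; first exact: gen_spanP.
by move=> i; apply: MM.
Qed.

Lemma integral_peval x p : integralOver f x -> integralOver f (peval x p).
Proof.
move=> xi; apply: integral_horner => //; apply/integral_poly => i.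
by rewrite coef_map; apply: integral_id.
Qed.

(** An integral equation of degree [n.+1] for [v], multiplied by [w ^+ n], expresses [v] as a
    polynomial in [w]. *)
Lemma integral_inverse w v : integralOver f v -> w * v = 1 -> exists p, v = peval w p.
Proof.
move=> /integral_pow[n [c e]] wv.
case: n e => [|n] e.
  exists 0; rewrite /peval rmorph0 horner0.
  by move: e; rewrite big_ord0 expr0 => /eqP; rewrite oner_eq0.
exists (\sum_(k < n.+1) (c k)%:P * 'X^(n - k)).
have -> : v = w ^+ n * v ^+ n.+1 by rewrite exprSr mulrA -exprMn wv expr1n mul1r.
rewrite e mulr_sumr.
rewrite peval_sum; apply: eq_bigr => k _.
rewrite pevalM pevalC pevalXn mulrCA; congr (_ * _).
rewrite -{1}(subnK (ltn_ord k : (k <= n)%N)) exprD -mulrA -exprMn wv expr1n mulr1 //.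
Qed.

Lemma unit_descent r v : integralOver f v -> f r * v = 1 -> exists s, s * r = 1.
Proof.
move=> vi rv; have [p vE] := integral_inverse vi rv.
have pE : peval (f r) p = f p.[r] by rewrite /peval horner_map.
exists p.[r]; apply: f_inj; rewrite rmorphM -pE -vE rmorph1 mulrC //.
Qed.

(** * Polynomial relations of bounded degree *)

Section BoundedDegree.
Hypothesis noeth : noetherian R.
Variable b : R.
Hypothesis jb : jacobson b.
Hypothesis b0 : b <> 0.
Hypothesis pb : forall P, prime_ideal P -> P b -> maximal_ideal P.

(** For [M] spanned by the powers of [x] up to [e], [M / bM] has length at most [e]. Adjoining these
    [e.+1] powers one by one to the Jacobson radical times [M] therefore cannot always be strict.
    The resulting relation has the unit [1 - c i] as coefficient of [x ^+ i]. *)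
Lemma unit_coef_relation e x : len_le f e (scale (f b) top) top ->
  exists i, (i <= e)%N /\ msum (jac_span f e.+1 (fun k => x ^+ k))
     (gen_span f i (fun k => x ^+ k)) (x ^+ i).
Proof.
move=> he; pose g k := x ^+ k.
have [d [d0 dM]] := common_denominator e.+1 g.
have sM := gen_spanP f e.+1 g.
have heM := len_le_fractional f_inj noeth jb pb b0 d0 sM dM he.
apply: contrapT => h.
pose C i := msum (jac_span f e.+1 g) (gen_span f i g).
suff : (e.+1 <= e)%N by rewrite ltnn.
apply: (@len_le_chain _ _ f e e.+1 C (gen_span f e.+1 g)).
- apply: len_le_sub heM => _ [y [My ->]].
  exists (f b * y), 0; split; [exact: jac_span_mul| |by rewrite addr0].
  by have [] := gen_spanP f 0 g.
- by move=> i; apply: msumP; [apply: jac_span_submod|apply: gen_spanP].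
- move=> i iN _ [u [v [ju gv ->]]]; exists u, v; split=> //.
  exact: gen_span_mono gv.
- move=> i iN; exists (g i); split.
    exists 0, (g i); rewrite add0r; split=> //; last exact: gen_span_gen.
    by have [] := jac_span_submod e.+1 g.
  by move=> Ci; apply: h; exists i.
- move=> i iN; apply: (msum_sub sM); first exact: jac_span_sub.
  exact: gen_span_mono.
Qed.

(** Integrality makes [R[x]] finitely generated, and the relation of [unit_coef_relation] shows that
    the powers below [i] span it modulo the Jacobson radical; Nakayama's lemma concludes. *)
Lemma integral_bounded_degree e x : len_le f e (scale (f b) top) top ->
  integralOver f x -> exists c : nat -> R, x ^+ e = \sum_(k < e) f (c k) * x ^+ k.
Proof.
move=> he xi; pose g k := x ^+ k.
have [i [ie [u [_ [ju [c ->] xE]]]]] := unit_coef_relation x he.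
have [n nP] := integral_span xi.
have gn k : gen_span f n g (g k) by apply/nP; exists 'X^k; rewrite pevalXn.
have sJ := jac_span_submod n g; have sN := gen_spanP f i g.
have sS : submod f (msum (gen_span f i g) (jac_span f n g)) by apply: msumP.
have [_ _ SM] := sS.
have gS k : msum (gen_span f i g) (jac_span f n g) (g k).
  elim/ltn_ind: k => k IH; have [ki|ik] := ltnP k i.
    by apply: (msum_l sJ); apply: gen_span_gen.
  rewrite /g -(subnK ik) exprD xE mulrDr.
  have [_ SA _] := sS; apply: SA.
    apply: (msum_r sN); case: ju => d [jd ->]; rewrite mulr_sumr.
    apply: (submod_sum sJ) => l; rewrite mulrCA -exprD; exact: jac_span_mul.
  rewrite mulr_sumr; apply: (submod_sum sS) => l; rewrite mulrCA -exprD.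
  apply: (SM); apply: IH.
  by have := ltn_ord l; lia.
have : incl (gen_span f n g) (gen_span f i g).
  by apply: nakayama => //; apply: (gen_span_sub sS).
by move=> /(_ _ (gn e)) /(gen_span_mono ie).
Qed.

(* If [x = y ^ q], then [R[y] > y R[y] > ... > y ^ q R[y] = x R[y]] is a chain of
   length [q], bounded by the length of [R / cR] for any nonzero [c] in [x R[x] :&: R]. *)
Lemma bounded_roots x : integralOver f x -> x <> 0 ->
  ~ (exists v, integralOver f v /\ x * v = 1) ->
  exists B, forall q y, integralOver f y -> y ^+ q = x -> (q <= B)%N.
Proof.
move=> xi x0 nu.
(* In a monic equation for [x], divided by the variable as long as the constant term vanishes, the
   constant term is a nonzero multiple of [x] in [R[x]]. *)
have [c [p [c0 cE]]] : exists c p, c <> 0 /\ f c = x * peval x p.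
  case: xi => p; have [n] := ubnP (size p); elim: n p => // n IH p sp pm.
  move=> /eqP xp; have {}xp : peval x p = 0 by exact: xp.
  have e : p = drop_poly 1 p * 'X + (p`_0)%:P.
    apply/polyP => -[|i]; rewrite coefD coefMX coefC ?add0r //=.
    by rewrite addr0 coef_drop_poly addn1.
  have [p0|p0] := pselect (p`_0 = 0); last first.
    exists p`_0, (- drop_poly 1 p); split=> //.
    move: xp; rewrite {1}e pevalD pevalM pevalX pevalC => /eqP.
    rewrite addr_eq0 => /eqP h.
    by rewrite /peval rmorphN hornerN mulrN -[LHS]opprK -h mulrC.
  rewrite p0 addr0 in e.
  have dm : drop_poly 1 p \is monic.
    by move: pm; rewrite {1}e !monicE lead_coefMX.
  apply: (IH (drop_poly 1 p)) => //.
    have : size p != 0%N by rewrite size_poly_eq0 monic_neq0.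
    by rewrite size_drop_poly; lia.
  move: xp; rewrite {1}e pevalM pevalX => /eqP.
  by rewrite mulf_eq0 => /orP[//|/eqP//].
have [B hB] := finite_colength f_inj noeth jb pb c0.
exists B => q y yi yq.
have [n nP] := integral_span yi.
pose M := gen_span f n (fun k => y ^+ k).
have sM : submod f M by apply: gen_spanP.
have [d [d0 dM]] := common_denominator n (fun k => y ^+ k).
have hM := len_le_fractional f_inj noeth jb pb c0 d0 sM dM hB.
have yM k z : M z -> M (y ^+ k * z).
  by move=> /nP[r ->]; apply/nP; exists ('X^k * r); rewrite pevalM pevalXn.
have xM r z : M z -> M (peval x r * z).
  move=> Mz; rewrite pevalE mulr_suml; apply: (submod_sum sM) => i.
  by rewrite -mulrA; have [_ _] := sM; apply; rewrite -yq -exprM; apply: yM.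
apply: (@len_le_chain _ _ f B q (fun i => scale (y ^+ (q - i)) M) M) => /=.
- apply: len_le_sub hM => _ [z [Mz ->]]; rewrite subn0 yq cE.
  by exists (peval x p * z); rewrite mulrA; split=> //; apply: xM.
- by move=> i; apply: scaleP.
- move=> i iq _ [z [Mz ->]]; exists (y ^+ 1 * z); split; first exact: yM.
  by rewrite mulrA -exprD; congr (y ^+ _ * _); lia.
- move=> i iq; exists (y ^+ (q - i.+1)); split.
    exists 1; rewrite mulr1; split=> //; apply/nP; exists 1.
    by rewrite /peval rmorph1 hornerC.
  move=> [z [Mz e]]; apply: nu.
  have y0 : y ^+ (q - i.+1) != 0.
    apply/eqP => h; apply: x0; rewrite -yq.
    have -> : q = (q - i.+1 + i.+1)%N by lia.
    by rewrite exprD h mul0r.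
  have yz : y * z = 1.
    apply: (mulfI y0); rewrite mulr1 {2}e mulrA -exprSr; congr (y ^+ _ * _); lia.
  have zi : integralOver f z by move/nP: Mz => [r ->]; apply: integral_peval.
  exists (z ^+ q); split; last by rewrite -yq -exprMn yz expr1n.
  elim: (q) => [|k IH]; first by rewrite expr0; apply: integral1.
  by rewrite exprS; apply: integral_mul.
- move=> i iq _ [z [Mz ->]]; exact: yM.
Qed.

End BoundedDegree.
End Integral.

(** * The integral closure is a henselian valuation ring *)

Lemma domain_of_injective (R : comNzRingType) (K : fieldType) (f : {rmorphism R -> K}) :
  injective f -> integral_domain R.
Proof.
move=> f_inj; split; first by apply/eqP; apply: oner_neq0.
move=> a b /(congr1 f); rewrite rmorphM rmorph0 => /eqP.
by rewrite mulf_eq0 -!(rmorph0 f) => /orP[] /eqP /f_inj; [left|right].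
Qed.

Lemma valuation_ring_of_field (O : comNzRingType) (K : fieldType) (k : {rmorphism O -> K}) :
  injective k -> (forall x, (exists o, k o = x) \/ (exists o, k o = x^-1)) ->
  valuation_ring O.
Proof.
move=> k_inj hk; split; first exact: domain_of_injective k_inj.
have k0 c : c <> 0 -> k c != 0.
  by move=> c0; apply/eqP => e; apply: c0; apply: k_inj; rewrite e rmorph0.
move=> a b; have [->|/k0 a0] := pselect (a = 0).
  by right; exists 0; rewrite mulr0.
have [->|/k0 b0] := pselect (b = 0).
  by left; exists 0; rewrite mulr0.
have [[o e]|[o e]] := hk (k b / k a); [left|right]; exists o; apply: k_inj.
  by rewrite rmorphM e mulrC divfK.
by rewrite rmorphM e invf_div mulrC divfK.
Qed.

(** The nonunits form an ideal: of two of them one divides the other, hence also their sum. *)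
Lemma valuation_ring_maximal (O : comNzRingType) (m : O -> Prop) :
  valuation_ring O -> maximal_ideal m -> forall z, m z <-> ~ exists y, y * z = 1.
Proof.
move=> [[o10 D] V] [[hm m1] mmax] z; split=> [mz [y e]|].
  by apply: m1; rewrite -e; case: hm => _ _; apply.
apply: (mmax (fun z => ~ exists y, y * z = 1)) => {z} [|z mz [y e]].
  split; last by apply; exists 1; rewrite mulr1.
  split=> [[y]|x y nx ny [u e]|r x nx [u e]].
  - by rewrite mulr0 => /esym.
  - case: (V x y) => -[c E].
      by apply: nx; exists (u * (1 + c)); rewrite -[RHS]e E; ring.
    by apply: ny; exists (u * (1 + c)); rewrite -[RHS]e E; ring.
  - by apply: nx; exists (u * r); rewrite -mulrA.
by apply: m1; rewrite -e; case: hm => _ _; apply.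
Qed.

Lemma maximal_unique_unit (T : comNzRingType) (n : T -> Prop) :
  (forall m, maximal_ideal m -> m = n) -> forall t, ~ n t -> exists u, u * t = 1.
Proof. by move=> uniq t nt; have [//|[M [/uniq -> /nt]]] := unit_or_maximal t. Qed.

Section IntegralClosure.
Variables (R T : comNzRingType) (K : fieldType).
Variables (f : {rmorphism R -> K}) (j : {rmorphism T -> K}).
Hypothesis f_inj : injective f.
Hypothesis j_inj : injective j.
Hypothesis fracK : forall x, exists a b, f b != 0 /\ x = f a / f b.
Hypothesis T_integral : forall x, integralOver f x <-> exists t, j t = x.
Let top := ring_image f.

Let j0 t : t <> 0 -> j t != 0.
Proof. by move=> t0; apply/eqP => e; apply: t0; apply: j_inj; rewrite e rmorph0. Qed.

Lemma integrally_closed n (c : nat -> T) y :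
  y ^+ n = \sum_(k < n) j (c k) * y ^+ k -> exists t, j t = y.
Proof.
move=> e; apply/T_integral; apply: (@integral_of_pow _ _ f n y (fun k => j (c k))) => //.
by move=> k _; apply/T_integral; exists (c k).
Qed.

Lemma lift_to_closure : exists i : {rmorphism R -> T}, forall r, j (i r) = f r.
Proof.
have /choice[g gP] : forall r, exists t, j t = f r.
  by move=> r; apply/T_integral; apply: integral_id.
have [|||i iE] := @rmorphism_of R T g.
- by move=> x y; apply: j_inj; rewrite rmorphB !gP rmorphB.
- by move=> x y; apply: j_inj; rewrite rmorphM !gP rmorphM.
- by apply: j_inj; rewrite gP !rmorph1.
by exists i => r; rewrite iE.
Qed.

Definition localized (n : T -> Prop) (x : K) := exists t s, ~ n s /\ x = j t / j s.

(* Kaplansky's u, u^-1 lemma: a root of a polynomial with a coefficient outside [n]. *)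
Lemma localized_or_inv (n : T -> Prop) d (c : nat -> T) x : maximal_ideal n ->
  \sum_(k < d.+1) j (c k) * x ^+ k = 0 -> (exists i, (i <= d)%N /\ ~ n (c i)) ->
  localized n x \/ localized n x^-1.
Proof.
move=> /maximal_prime[hn n1 np]; have [n00 nA nM] := hn.
have jn s : ~ n s -> j s != 0 by move=> ns; apply: j0 => s0; apply: ns; rewrite s0.
elim: d c => [|d IH] c e [i [id nci]].
  case: nci; move: id e; rewrite leqn0 => /eqP ->.
  by rewrite big_ord1 mulr1 -(rmorph0 j) => /j_inj ->.
have eq : j (c d.+1) * x ^+ d.+1 = - \sum_(k < d.+1) j (c k) * x ^+ k.
  by have := e; rewrite big_ord_recr /= addrC => /eqP; rewrite addr_eq0 => /eqP.
(* Multiplying the relation by [c d.+1 ^+ d] gives a monic equation for [y]. *)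
have [y yE] : exists y, j y = j (c d.+1) * x.
  apply: (@integrally_closed d.+1 (fun k => - (c k * c d.+1 ^+ (d - k)))).
  rewrite exprMn exprSr -mulrA eq mulrN mulr_sumr -sumrN; apply: eq_bigr => k _.
  rewrite rmorphN mulNr rmorphM rmorphXn exprMn; congr (- _).
  have -> : j (c d.+1) ^+ d = j (c d.+1) ^+ (d - k) * j (c d.+1) ^+ k.
    by rewrite -exprD subnK // -ltnS.
  ring.
have [nc|nc] := pselect (n (c d.+1)); last first.
  by left; exists y, (c d.+1); split=> //; rewrite yE mulrC mulKf // jn.
have [ny|ny] := pselect (n y); last first.
  right; exists (c d.+1), y; split=> //.
  have := jn _ ny; rewrite yE mulf_eq0 negb_or => /andP[c0 x0].
  by rewrite invfM mulrA divff // mul1r.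
(* When the leading coefficient and [y] both lie in [n], the leading term is absorbed in degree [d],
   which changes no lower coefficient modulo [n]. *)
pose c' k := if k == d then c d + y else c k.
apply: (IH c').
  rewrite big_ord_recr /= /c' eqxx -[RHS]e !big_ord_recr /= rmorphD mulrDl yE addrA.
  rewrite -mulrA -exprS; congr (_ + _ + _).
  by apply: eq_bigr => k _; rewrite ltn_eqF.
have ne : i != d.+1 by apply/eqP => E; apply: nci; rewrite E.
exists i; split; first by lia.
rewrite /c'; case: eqP => [E|//]; rewrite -E => h; apply: nci.
have -> : c i = (c i + y) - y by rewrite addrK.
exact: ideal_sub.
Qed.

Hypothesis noeth : noetherian R.
Variable b : R.
Hypothesis jb : jacobson b.
Hypothesis b0 : b <> 0.
Hypothesis pb : forall P, prime_ideal P -> P b -> maximal_ideal P.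

Lemma localized_total (n : T -> Prop) x : maximal_ideal n ->
  localized n x \/ localized n x^-1.
Proof.
move=> nmax; have [e he] := finite_colength f_inj noeth jb pb b0.
have [i [ie [_ [_ [[c [jc ->]] [c' ->] xE]]]]] :=
  unit_coef_relation f_inj fracK noeth jb b0 pb x he.
have [l lE] := lift_to_closure.
(* The relation of [unit_coef_relation] moved to one side; its coefficient [1 - c i] is a unit of
   [R], so its image is outside [n]. *)
pose q k := (k == i)%:R - c k - (if (k < i)%N then c' k else 0).
apply: (@localized_or_inv n e (fun k => l (q k))) => //.
  rewrite (eq_bigr (fun k : 'I_e.+1 => (if k == i :> nat then x ^+ k else 0) -
      f (c k) * x ^+ k - (if (k < i)%N then f (c' k) * x ^+ k else 0))); last first.
    move=> k _; rewrite lE /q !rmorphB !mulrBl.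
    by case: (k == i :> nat); case: (k < i)%N; rewrite ?rmorph1 ?rmorph0 ?mul1r ?mul0r.
  rewrite !sumrB -!big_mkcond /=.
  have iN : (i < e.+1)%N by [].
  rewrite (big_pred1 (Ordinal iN)) /=; last by [].
  apply/eqP; rewrite subr_eq0 subr_eq xE addrC; apply/eqP; congr (_ + _).
  by rewrite (big_ord_widen _ (fun k => f (c' k) * x ^+ k) (ltnW iN)).
exists i; split=> //; rewrite /q eqxx ltnn subr0.
have [u uE] := jacobson_unit (jc i).
have [[hn n1] _] := nmax; move=> nq; apply: n1.
by rewrite -(rmorph1 l) -uE rmorphM; case: hn => _ _; apply.
Qed.

(** The element [a] makes the localization definable: [n] is the only maximal ideal containing [a],
    so [s] is outside [n] exactly when [s] and [a] generate the unit ideal. *)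
Lemma localization_valuation (n : T -> Prop) a : maximal_ideal n -> n a ->
  (forall n', maximal_ideal n' -> n' <> n -> n' (1 - a)) -> NIP T ->
  exists (O : comNzRingType) (k : {rmorphism O -> K}),
    [/\ injective k, forall x, localized n x <-> exists o, k o = x,
        valuation_ring O & NIP O].
Proof.
move=> nmax na nsep hT.
have [hn n1 np] := maximal_prime nmax; have [n00 nA nM] := hn.
have jn s : ~ n s -> j s != 0 by move=> ns; apply: j0 => s0; apply: ns; rewrite s0.
have nmul s s' : ~ n s -> ~ n s' -> ~ n (s * s') by move=> ns ns' /np[].
have [|||O [k [k_inj kE]]] := @subring K (localized n).
- by exists 1, 1; split=> //; rewrite rmorph1 divr1.
- move=> _ _ [t [s [ns ->]]] [t' [s' [ns' ->]]].
  exists (t * s' - t' * s), (s * s'); split; first exact: nmul.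
  by rewrite -mulNr addf_div ?jn // rmorphB !rmorphM mulNr.
- move=> _ _ [t [s [ns ->]]] [t' [s' [ns' ->]]].
  exists (t * t'), (s * s'); split; first exact: nmul.
  by rewrite mulf_div !rmorphM.
exists O, k; split=> //.
  apply: (valuation_ring_of_field k_inj) => x.
  by have [/kE|/kE] := localized_total x nmax; [left|right].
pose D (t s : T) := exists u v, u * s + v * a = 1.
have Dn t s : D t s <-> ~ n s.
  split=> [[u [v e]] ns|ns].
    by apply: n1; rewrite -e; apply: nA; apply: nM.
  apply: contrapT => nD.
  have hI := ideal_adjoinP a (principal_ideal s).
  have [|M [MM IM]] := @exists_maximal T (ideal_adjoin (fun x => exists r, x = r * s) a).
    split=> // -[_ [v [[u ->] e]]]; apply: nD; exists u, v; by rewrite e.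
  have Ma : M a by apply: IM; apply: ideal_adjoin_gen; apply: principal_ideal.
  have Ms : M s by apply: IM; apply: ideal_adjoinS; exists 1; rewrite mul1r.
  have [MA M1 _] := maximal_prime MM; apply: M1.
  have [_ MD _] := MA; rewrite -(subrK a 1); apply: MD => //.
  by apply: nsep => // E; apply: ns; rewrite -E.
pose phi := FExists 11 (FExists 15 (FEq (RAdd (RMul (RVar 11) (RVar 7))
  (RMul (RVar 15) (RVar 2))) ROne)).
apply: (@NIP_fractions T O K j k D phi (fun _ => a)) => //.
- by move=> t s /(Dn t s) ns s0; apply: ns; rewrite s0.
- move=> x; rewrite -kE; split=> -[t [s [h ->]]]; exists t, s; split=> //.
    exact/(Dn t s).
  exact/(Dn t s).
- move=> e ew; have := ew 0%N; rewrite /= /upd /= => ->.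
  by split=> -[u [v h]]; exists u, v.
Qed.

(* Take [x] in [n2] with [1 - x] in [n1].  Hensel's lemma at [n1] gives [q ^ k]-th roots of
   [x] for all [k], where [q] is [2] or [3], contradicting [bounded_roots]. *)
Lemma closure_local : henselianity_conjecture -> NIP T ->
  forall n1 n2 : T -> Prop, maximal_ideal n1 -> maximal_ideal n2 -> n1 = n2.
Proof.
move=> HC hT n1 n2 n1m n2m; apply: contrapT => neq.
have [x [n2x n1x]] := distinct_comaximal n2m n1m (fun e => neq (esym e)).
have [r [m [mP mall]]] := NIP_finite_maximal hT.
have [i [ir n1E]] := mall _ n1m.
have [a [ma asep]] := maximal_separator mP ir.
have [|n' n'm n'n|//|O [k [k_inj kE OV ON]]] := @localization_valuation n1 a n1m.
- by rewrite n1E.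
- have [i' [i'r n'E]] := mall _ n'm; rewrite n'E; apply: asep => // E.
  by apply: n'n; rewrite n'E n1E E.
have [[mO [mOm _]] hens] := HC O OV ON.
have mOE := valuation_ring_maximal OV mOm.
have [hn n11 np] := maximal_prime n1m; have [n00 nA nM] := hn.
have jn s : ~ n1 s -> j s != 0 by move=> ns; apply: j0 => s0; apply: ns; rewrite s0.
(* A proper ideal cannot contain both [2] and [3]. *)
have [q q1 nq] : exists2 q, (1 < q)%N & ~ n1 q%:R.
  have [n2'|] := pselect (n1 2%:R); last by exists 2%N.
  exists 3%N => // n3; apply: n11; have -> : 1 = 3%:R - 2%:R :> T by ring.
  exact: ideal_sub.
have xi : integralOver f (j x) by apply/T_integral; exists x.
have x0 : j x <> 0.
  move=> jx; have {}jx : x = 0 by apply: j_inj; rewrite jx rmorph0.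
  by apply: n11; rewrite jx subr0 in n1x.
have nux : ~ exists v, integralOver f v /\ j x * v = 1.
  move=> [v [/T_integral[t <-]]]; rewrite -rmorphM -(rmorph1 j) => /j_inj e.
  by have [[hn2 n21] _] := n2m; apply: n21; rewrite -e; apply: ideal_mulr.
have [B hB] := bounded_roots f_inj fracK noeth jb pb xi x0 nux.
(* [Q] exceeds [B] and, as a power of [q], lies outside [n1]; so [1] is a simple root of ['X^Q - x]
   modulo the maximal ideal of [O]. *)
pose Q := (q ^ B.+1)%N.
have BQ : (B < Q)%N by apply: ltnW; apply: ltn_expl.
have nQ : ~ n1 Q%:R.
  rewrite /Q natrX; elim: B.+1 => [|l IH]; rewrite ?expr0 // exprS.
  by case/np.
have [xO xOE] : exists o, k o = j x.
  by apply/kE; exists x, 1; rewrite rmorph1 divr1.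
pose p : {poly O} := 'X^Q - xO%:P.
have Q0 : (0 < Q)%N by apply: leq_ltn_trans BQ.
have [|||y [/eqP yr _]] := hens mO mOm p 1.
- exact: monicXnsubC.
- rewrite /p !hornerE expr1n; apply/mOE => -[y /(congr1 k)].
  rewrite rmorphM rmorphB xOE !rmorph1.
  have /kE[t [s [ns ->]]] : exists o, k o = k y by exists y.
  rewrite mulrAC -(rmorph1 j) -rmorphB => /(canRL (divfK (jn _ ns))).
  rewrite rmorph1 mul1r -rmorphM => /j_inj e.
  by apply: ns; rewrite -e; apply: nM.
- rewrite /p derivB derivC subr0 derivXn hornerMn hornerXn expr1n => /mOE; apply.
  have [o oE] : exists o, k o = (j Q%:R)^-1.
    by apply/kE; exists 1, Q%:R; rewrite rmorph1 mul1r.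
  exists o; apply: k_inj; rewrite rmorphM oE rmorph1 !rmorph_nat mulVf //.
  by rewrite -(rmorph_nat j) jn.
have yQ : k y ^+ Q = j x.
  move: yr; rewrite /p !hornerE => /eqP; rewrite subr_eq0 => /eqP e.
  by rewrite -rmorphXn e.
have yi : integralOver f (k y).
  apply: (@integral_of_pow _ _ f Q _ (fun l => if l == 0%N then j x else 0)).
    by move=> l _; case: eqP => // _; apply: integral0.
  rewrite yQ -(prednK Q0) big_ord_recl /= mulr1 big1 ?addr0 // => l _.
  by rewrite mul0r.
by have := hB Q _ yi yQ; rewrite leqNgt BQ.
Qed.

(** Integral equations can all be taken of the same degree [e]. For a fraction [u / v], clearing
    denominators turns such an equation into a formula with [e] quantified coefficients. *)
Lemma integral_closure_definable : NIP R -> NIP T.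
Proof.
have [e he] := finite_colength f_inj noeth jb pb b0.
pose D (u v : R) := v <> 0 /\
  exists c : nat -> R, u ^+ e = \sum_(k < e) c k * (u ^+ k * v ^+ (e - k)).
have fN0 v : v <> 0 -> f v != 0.
  by move=> v0; apply/eqP => E; apply: v0; apply: f_inj; rewrite E rmorph0.
pose body := FEq (pow_term (RVar 3) e)
  (sum_term e (fun k => RMul (RVar (4 * k + 19))
     (RMul (pow_term (RVar 3) k) (pow_term (RVar 7) (e - k))))).
have relE u v (c : nat -> R) : v <> 0 ->
    u ^+ e = \sum_(k < e) c k * (u ^+ k * v ^+ (e - k)) <->
    (f u / f v) ^+ e = \sum_(k < e) f (c k) * (f u / f v) ^+ k.
  move=> /fN0 v0; have ve : f v ^+ e != 0 by apply: expf_neq0.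
  have E : \sum_(k < e) f (c k) * (f u / f v) ^+ k =
      f (\sum_(k < e) c k * (u ^+ k * v ^+ (e - k))) / f v ^+ e.
    rewrite rmorph_sum mulr_suml; apply: eq_bigr => k _.
    rewrite !rmorphM !rmorphXn expr_div_n -!mulrA; congr (_ * (_ * _)).
    have -> : f v ^+ e = f v ^+ (e - k) * f v ^+ k by rewrite -exprD subnK // ltnW.
    by rewrite invfM mulrA divff ?mul1r // expf_neq0.
  rewrite E expr_div_n; split=> [<-|h]; first by rewrite rmorphXn.
  apply: f_inj; rewrite rmorphXn; apply: (mulIf _ h).
  by rewrite invr_eq0.
apply: (@NIP_fractions R T K f j D (FAnd (FNot (FEq (RVar 7) RZero)) (exs e body))
   (fun _ => 0)) => //.
- by move=> u v [].
- move=> x; rewrite -T_integral; split=> [xi|[u [v [[v0 [c cE]] xE]]]].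
    have [u [v [v0 xE]]] := fracK x.
    have vn : v <> 0 by move=> E; rewrite E rmorph0 eqxx in v0.
    have [c cE] := integral_bounded_degree f_inj fracK noeth jb b0 pb he xi.
    exists u, v; split=> //; split=> //; exists c; apply/relE => //.
    by rewrite -xE.
  move/(relE u v c v0): cE; rewrite -xE => E.
  apply: (@integral_of_pow _ _ f e x (fun k => f (c k)) _ E) => k _.
  exact: integral_id.
move=> env _; rewrite /D; cbn [fsat teval]; rewrite exsE.
have E c : fsat (with_scratch env e c) body <->
    env 3%N ^+ e = \sum_(k < e) c k * (env 3%N ^+ k * env 7%N ^+ (e - k)).
  rewrite /body; cbn [fsat]; rewrite teval_pow teval_sum; cbn [teval].
  rewrite with_scratch_low //.
  rewrite [X in _ = X <-> _](eq_bigr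
    (fun k : 'I_e => c k * (env 3%N ^+ k * env 7%N ^+ (e - k)))) // => k _.
  cbn [teval]; rewrite !teval_pow; cbn [teval].
  by rewrite with_scratch_new // !with_scratch_low.
by split=> -[h [c hc]]; split=> //; exists c; apply/E.
Qed.

End IntegralClosure.

(** * Descent and decomposition *)

(** [q] is the divided difference of [g] at [y], whose value at [y] is the derivative; this is the
    first-order Taylor expansion, and applying it again to [q] gives the second-order one. *)
Lemma horner_sub (A : comNzRingType) (g : {poly A}) x y :
  exists q : {poly A}, [/\ g.[x] - g.[y] = (x - y) * q.[x], q.[y] = g^`().[y] &
    g - g.[y]%:P = q * ('X - y%:P)].
Proof.
have : root (g - g.[y]%:P) y by rewrite /root !hornerE subrr.
move=> /factor_theorem[q qE]; exists q; split=> //.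
  by have := congr1 (fun p => p.[x]) qE; rewrite !hornerE mulrC.
have := congr1 (fun p => p^`().[y]) qE.
by rewrite derivB derivC subr0 derivM derivXsubC !hornerE subrr mulr0 add0r.
Qed.

Lemma field_henselian (A : comNzRingType) :
  maximal_ideal (fun x : A => x = 0) -> henselian_local A.
Proof.
move=> h0; have uniq (m : A -> Prop) : maximal_ideal m -> forall x, m x -> x = 0.
  move=> [pm _] x mx; have [_ /(_ m pm)] := h0; apply=> // _ ->.
  by case: pm => -[].
split; first exists (fun x => x = 0).
  split=> // m mm x; split; first exact: uniq.
  by move=> ->; case: mm => -[[]].
move=> m mm g a0 _ /(uniq _ mm) ga0 _; exists a0; split; first exact/eqP.
by rewrite subrr; case: mm => -[[]].
Qed.

Lemma domain_henselian (R : comNzRingType) : henselianity_conjecture ->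
  NIP R -> noetherian R -> integral_domain R -> henselian_local R.
Proof.
move=> HC hR noeth dom; have [one0 D] := dom.
have [K [f [f_inj fracK]]] := fraction_field dom.
have [N hN] := NIP_divides hR.
have [n0 [mx [[mxP _] mx_all]]] := NIP_finite_maximal hR.
have p0 : prime_ideal (fun x : R => x = 0) by split=> //; apply: zero_ideal.
(* If the zero ideal is maximal, an approximate root is already a root; otherwise it is a nonmaximal
   prime, and the Jacobson radical has a nonzero element. *)
have [/field_henselian //|/(jacobson_not_prime mxP mx_all p0)[b' [jb' b'0]]] :=
  pselect (maximal_ideal (fun x : R => x = 0)).
have [b [jb b0 pb]] := exists_parameter noeth dom mxP mx_all hN jb' b'0.
have [|||T [j [j_inj T_int]]] := @subring K (integralOver f).
- exact: integral1.
- by move=> x y; apply: integral_sub.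
- by move=> x y; apply: integral_mul.
have hT := integral_closure_definable f_inj j_inj fracK T_int noeth jb b0 pb hR.
have Tloc := closure_local f_inj j_inj fracK T_int noeth jb b0 pb HC hT.
have [n [nm _]] : exists n : T -> Prop, maximal_ideal n /\ forall x, x = 0 -> n x.
  apply: exists_maximal; split; first exact: zero_ideal.
  by apply/eqP; apply: oner_neq0.
have uT := maximal_unique_unit (fun m mm => Tloc m n mm nm).
have TV : valuation_ring T.
  apply: (valuation_ring_of_field j_inj) => x.
  have loc z : localized j n z -> exists t, j t = z.
    move=> [t [s [/uT[u us] ->]]]; exists (t * u).
    have e : j u * j s = 1 by rewrite -rmorphM us rmorph1.
    have s0 : j s != 0 by apply/eqP => s0; move/eqP: e; rewrite s0 mulr0 eq_sym oner_eq0.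
    by apply: (mulIf s0); rewrite divfK // rmorphM -mulrA e mulr1.
  have [/loc|/loc] := localized_total f_inj j_inj fracK T_int noeth jb b0 pb x nm; auto.
have [_ Thens] := HC T TV hT.
have [i iE] := lift_to_closure j_inj T_int.
have [hn n1 np] := maximal_prime nm; have [n00 nA nM] := hn.
(* An inverse of [i r] in [T] is integral over [R], hence in [R]; consequently every maximal ideal
   of [R] is the preimage of [n]. *)
have descent r : ~ n (i r) -> exists s, s * r = 1.
  move=> /uT[u uE]; apply: (unit_descent f_inj (v := j u)).
    by apply/T_int; exists u.
  by rewrite -iE -rmorphM mulrC uE rmorph1.
have mn (m : R -> Prop) r : maximal_ideal m -> m r <-> n (i r).
  move=> [[[m0 mA mM] m1] mmax]; split=> [mr|].
    by apply: contrapT => /descent[s sr]; apply: m1; rewrite -sr; apply: mM.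
  apply: (mmax (fun r => n (i r))) => {r} [|r mr].
    split; last by rewrite rmorph1.
    split; first by rewrite rmorph0.
      by move=> x y nx ny; rewrite rmorphD; apply: nA.
    by move=> x y ny; rewrite rmorphM; apply: nM.
  by apply: contrapT => /descent[s sr]; apply: m1; rewrite -sr; apply: mM.
have Rloc (m m' : R -> Prop) : maximal_ideal m -> maximal_ideal m' -> m = m'.
  move=> mm mm'; apply/funext => x; apply/propext.
  by rewrite (mn m x mm) (mn m' x mm').
split.
  have [m [mm _]] : exists m : R -> Prop, maximal_ideal m /\ forall x, x = 0 -> m x.
    by apply: exists_maximal; split => //; apply: zero_ideal.
  by exists m; split=> // m' mm' x; rewrite (Rloc m m').
move=> m mm g a0 gm mga mga'.
have [|||al [alr nal]] := Thens n nm (map_poly i g) (i a0).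
- exact: monic_map.
- by rewrite horner_map; apply/(mn m).
- by rewrite deriv_map horner_map => /(mn m _ mm).
have jac r : m r -> jacobson r by move=> mr M MM; rewrite -(Rloc m M).
have ali : integralOver f (j al) by apply/T_int; exists al.
have jmap (p : {poly R}) : j (map_poly i p).[al] = peval f (j al) p.
  rewrite /peval -horner_map -map_poly_comp; congr (_.[_]).
  by apply: eq_map_poly => r /=; rewrite iE.
have gal : peval f (j al) g = 0 by rewrite -jmap (eqP alr) rmorph0.
(* Dividing [g - g.[a0]] by ['X - a0] and evaluating at the root [al] gives [w * (al - a0) = -
   g.[a0]]. Here [w] is congruent to the derivative at [a0], hence a unit of [T]. *)
have [q [_ qa0 qE]] := horner_sub g 0 a0.
pose w := (map_poly i q).[al].
have wz : w * (al - i a0) = - i g.[a0].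
  have /(congr1 (fun p => (map_poly i p).[al])) := qE.
  rewrite rmorphB rmorphM rmorphB /= !map_polyC map_polyX !hornerE => <-.
  by rewrite (eqP alr) sub0r.
have nw : ~ n w.
  have [q2 [e2 _ _]] := horner_sub (map_poly i q) al (i a0).
  move=> nw; apply: mga'; apply/(mn m) => //; rewrite -qa0.
  have -> : i q.[a0] = w - (al - i a0) * q2.[al] by rewrite -e2 horner_map /w; ring.
  by apply: ideal_sub => //; apply: ideal_mulr.
have [v vE] := uT w nw.
have vi : integralOver f (j v) by apply/T_int; exists v.
(* The inverse [v] is a polynomial in [w], hence in [al], so it stays in [R[al]]. *)
have [|p vp] := integral_inverse f_inj (w := j w) vi.
  by rewrite -rmorphM mulrC vE rmorph1.
have zE : j al = f a0 - f g.[a0] * j v.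
  rewrite -iE -iE -rmorphM -rmorphB; congr (j _).
  have -> : i g.[a0] = - (w * (al - i a0)) by rewrite wz opprK.
  have -> : i a0 - - (w * (al - i a0)) * v = i a0 + v * w * (al - i a0) by ring.
  by rewrite vE mul1r addrC subrK.
have [d dP] := integral_span f_inj ali.
pose M := gen_span f d (fun k => j al ^+ k).
have Mv k : M (j v * j al ^+ k).
  apply/dP; exists ((p \Po q) * 'X^k); rewrite pevalM pevalXn; congr (_ * _).
  by rewrite vp /peval map_comp_poly horner_comp -/(peval f _ q) -jmap.
have stop := ring_imageP f.
have sJ : submod f (jac_span f d (fun k => j al ^+ k)) by apply: jac_span_submod.
have sS := msumP stop sJ; have [_ SA SM] := sS.
(* Since [al = a0 - g.[a0] * v] with [g.[a0]] in the Jacobson radical, [R[al]] is [R] plus the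
   Jacobson radical times [R[al]]; by Nakayama's lemma [al] is in [R]. *)
have Sk k : msum (ring_image f) (jac_span f d (fun k => j al ^+ k)) (j al ^+ k).
  elim: k => [|k IH].
    by apply: (msum_l sJ); rewrite expr0; exists 1; rewrite rmorph1.
  have -> : j al ^+ k.+1 = f a0 * j al ^+ k - f g.[a0] * (j v * j al ^+ k).
    by rewrite exprS {1}zE; ring.
  apply: (submodB sS); first exact: SM.
  apply: (msum_r stop); apply: jac_span_mul; last exact: Mv.
  exact: jac.
have /(_ (j al))[|a [_ aE]] : incl M (ring_image f).
  by apply: nakayama => //; apply: (gen_span_sub sS).
  by apply/dP; exists 'X; rewrite pevalX.
exists a; split.
  apply/eqP; apply: f_inj; rewrite rmorph0 -gal aE.
  by rewrite /peval horner_map.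
apply/(mn m) => //; rewrite rmorphB.
suff -> : i a = al by [].
by apply: j_inj; rewrite iE aE.
Qed.

Lemma preimage_maximal (R Q : comPzRingType) (p : {rmorphism R -> Q}) (M : Q -> Prop) :
  (forall q, exists x, p x = q) -> maximal_ideal M -> maximal_ideal (fun x => M (p x)).
Proof.
move=> ponto [[[M0 MA MM] M1] Mmax]; split.
  split; last by rewrite rmorph1.
  split; first by rewrite rmorph0.
    by move=> x y Mx My; rewrite rmorphD; apply: MA.
  by move=> x y My; rewrite rmorphM; apply: MM.
move=> J [[J0 JA JM] J1] MJ x Jx.
have Jker z : p z = 0 -> J z by move=> pz; apply: MJ; rewrite pz.
apply: (Mmax (fun q => exists z, J z /\ p z = q)); last by exists x.
  split; last first.
    move=> [z [Jz pz]]; apply: J1; rewrite -(subrK z 1); apply: JA => //.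
    by apply: Jker; rewrite rmorphB rmorph1 pz subrr.
  split; first by exists 0; rewrite rmorph0.
    move=> _ _ [u [Ju <-]] [v [Jv <-]]; exists (u + v).
    by rewrite rmorphD; split=> //; apply: JA.
  move=> r _ [u [Ju <-]]; have [s <-] := ponto r.
  by exists (s * u); rewrite rmorphM; split=> //; apply: JM.
by move=> q Mq; have [z pz] := ponto q; exists z; split=> //; apply: MJ; rewrite pz.
Qed.

Lemma maximal_unique (R : comPzRingType) : local_ring R ->
  forall m m' : R -> Prop, maximal_ideal m -> maximal_ideal m' -> m = m'.
Proof.
move=> [m0 [_ h]] m m' mm mm'; apply/funext => x; apply/propext.
by rewrite (h m mm) (h m' mm').
Qed.

(** * From prime quotients to general Noetherian rings *)

Section NIPNoetherian.
Hypothesis HC : henselianity_conjecture.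

Lemma NIP_noetherian_quotient (R : comPzRingType) (I : R -> Prop) (Q : comNzRingType)
    (p : {rmorphism R -> Q}) : NIP R -> noetherian R -> is_ideal I ->
  (forall q, exists x, p x = q) -> (forall x, p x = 0 <-> I x) -> NIP Q.
Proof.
move=> hR noeth hI ponto pker; have [n [g gP]] := noeth_fg noeth hI.
by apply: (@NIP_quotient R Q p n g) => // x; rewrite pker.
Qed.

Lemma prime_quotient (R : comPzRingType) (P : R -> Prop) : NIP R -> noetherian R ->
  prime_ideal P -> exists (Q : comNzRingType) (p : {rmorphism R -> Q}),
    [/\ forall q, exists x, p x = q, forall x, p x = 0 <-> P x & henselian_local Q].
Proof.
move=> hR noeth [hP P1 PP].
have [Q [p [ponto pker]]] := quotient_ring (conj hP P1 : proper_ideal P).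
exists Q, p; split=> //; apply: domain_henselian => //.
- exact: NIP_noetherian_quotient ponto pker.
- exact: noetherian_quotient ponto noeth.
- split; first by apply/eqP; apply: oner_neq0.
  move=> x y; have [u <-] := ponto x; have [v <-] := ponto y.
  by rewrite -rmorphM !pker => /PP.
Qed.

(* Roots modulo [I + (c)] and modulo [I + (d)] congruent to [a0] differ by an element of
   the sum of these ideals, so they glue to a root modulo their intersection, whose
   square lies in [I] when [c * d] does; one Newton step then gives a root modulo [I]. *)
Lemma local_henselian (R : comNzRingType) : NIP R -> noetherian R -> local_ring R ->
  henselian_local R.
Proof.
move=> hR noeth locR; split=> // m mm g a0 gm mga mga'.
have uniq := maximal_unique locR.
have [[hm m1] mmax] := mm; have [m0 mA mM] := hm.
have um := maximal_unique_unit (fun m' mm' => uniq m' m mm' mm).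
have mcl (p : {poly R}) x y : m (x - y) -> m (p.[x] - p.[y]).
  by move=> mxy; have [q [-> _ _]] := horner_sub p x y; apply: ideal_mulr.
have mtr x y : m (x - y) -> m y -> m x by move=> mxy my; rewrite -(subrK y x); apply: mA.
pose H (I : R -> Prop) := exists a, I g.[a] /\ m (a - a0).
suff: H (fun x => x = 0) by move=> [a [ga ma]]; exists a; split=> //; apply/eqP.
apply: (noeth_prime_ind noeth); last exact: zero_ideal.
- by move=> I hI I1; exists a0; split; [apply: ideal_eq1|rewrite subrr].
- move=> P pP; have [hP P1 PP] := pP.
  have Pm x : P x -> m x.
    have [M [MM PM]] := exists_maximal (conj hP P1 : proper_ideal P).
    by rewrite (uniq m M mm MM); apply: PM.
  have [Q [p [ponto pker [[mQ [mQm _]] hens]]]] := prime_quotient hR noeth pP.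
  have mQE x : mQ (p x) <-> m x by rewrite (uniq m _ mm (preimage_maximal ponto mQm)).
  have [|||al [alr mal]] := hens mQ mQm (map_poly p g) (p a0).
  + exact: monic_map.
  + by rewrite horner_map; apply/mQE.
  + by rewrite deriv_map horner_map => /mQE.
  have [a aE] := ponto al; exists a; split.
    by apply/pker; rewrite -horner_map aE; apply/eqP.
  by apply/mQE; rewrite rmorphB aE.
move=> I c d hI Icd [a1 [Ia1 ma1]] [a2 [Ia2 ma2]].
have hIc := ideal_adjoinP c hI; have hId := ideal_adjoinP d hI.
have unit_deriv x : m (x - a0) -> ~ m g^`().[x].
  move=> mx mgx; apply: mga'; apply: (mtr _ _ _ mgx).
  by rewrite -opprB; apply: ideal_opp => //; apply: mcl.
have ma12 : m (a1 - a2).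
  have -> : a1 - a2 = (a1 - a0) - (a2 - a0) by ring.
  exact: ideal_sub.
have [q [qE qa2 _]] := horner_sub g a1 a2.
have [u uE] : exists u, u * q.[a1] = 1.
  apply: um => mq; apply: (unit_deriv a2 ma2); rewrite -qa2.
  by apply: (mtr _ _ _ mq); rewrite -opprB; apply: ideal_opp => //; apply: mcl.
have a12 : a1 - a2 = u * (g.[a1] - g.[a2]).
  by rewrite qE mulrCA uE mulr1.
(* The choice of [u] makes [a1 - u * g.[a1]] equal to [a2 - u * g.[a2]], so [a3] is a root modulo
   both ideals. *)
pose a3 := a1 - u * g.[a1].
have mg1 : m g.[a1] by apply: (mtr _ g.[a0]) => //; apply: mcl.
have ma3 : m (a3 - a0).
  have -> : a3 - a0 = (a1 - a0) - u * g.[a1] by rewrite /a3; ring.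
  by apply: ideal_sub => //; apply: mM.
have close (J : R -> Prop) x y : is_ideal J -> J (x - y) -> J g.[y] -> J g.[x].
  move=> hJ Jxy Jy; rewrite -(subrK g.[y] g.[x]); have [_ JA _] := hJ; apply: JA => //.
  by have [q' [-> _ _]] := horner_sub g x y; apply: ideal_mulr.
have L1 : ideal_adjoin I c g.[a3].
  apply: (close _ a3 a1) => //; have -> : a3 - a1 = - (u * g.[a1]) by rewrite /a3; ring.
  by apply: ideal_opp => //; have [_ _] := hIc; apply.
have L2 : ideal_adjoin I d g.[a3].
  apply: (close _ a3 a2) => //.
  have -> : a3 - a2 = - (u * g.[a2]) by rewrite /a3 addrAC a12; ring.
  by apply: ideal_opp => //; have [_ _] := hId; apply.
have LL : I (g.[a3] * g.[a3]).
  have [s [r [Is sE]]] := L1; have [s' [r' [Is' s'E]]] := L2.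
  rewrite {1}sE s'E.
  have -> : (s + r * c) * (s' + r' * d) =
    (s' + r' * d) * s + (r * c) * s' + (r * r') * (c * d) by ring.
  by have [_ IA IM] := hI; apply: (IA); [apply: IA|]; apply: IM.
have [v vE] := um _ (unit_deriv a3 ma3).
pose a4 := a3 - v * g.[a3].
have e43 : a4 - a3 = - (v * g.[a3]) by rewrite /a4; ring.
have mg3 : m g.[a3] by apply: (mtr _ g.[a0]) => //; apply: mcl.
exists a4; split; last first.
  have -> : a4 - a0 = (a3 - a0) - v * g.[a3] by rewrite /a4; ring.
  by apply: ideal_sub => //; apply: mM.
have [q' [q'E q'3 _]] := horner_sub g a4 a3.
have [q2 [q2E _ _]] := horner_sub q' a4 a3.
(* In the Newton step the linear term cancels, leaving a multiple of the square of [g.[a3]]. *)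
have -> : g.[a4] = (v * v * q2.[a4]) * (g.[a3] * g.[a3]).
  have E : q'.[a4] = g^`().[a3] - v * g.[a3] * q2.[a4].
    by rewrite -q'3 -(subrK q'.[a3] q'.[a4]) q2E e43; ring.
  rewrite -(subrK g.[a3] g.[a4]) q'E e43 E.
  have -> : - (v * g.[a3]) * (g^`().[a3] - v * g.[a3] * q2.[a4]) + g.[a3] =
    v * v * q2.[a4] * (g.[a3] * g.[a3]) + (1 - v * g^`().[a3]) * g.[a3] by ring.
  by rewrite vE subrr mul0r addr0.
by have [_ _] := hI; apply.
Qed.

Lemma comaximal (R : comPzRingType) (I J : R -> Prop) : is_ideal I -> is_ideal J ->
  (forall M : R -> Prop, maximal_ideal M -> (forall x, I x -> M x) ->
     (forall x, J x -> M x) -> False) -> exists x, I x /\ J (1 - x).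
Proof.
move=> [I0 IA IM] [J0 JA JM] h; apply: contrapT => nx.
pose S x := exists u v, [/\ I u, J v & x = u + v].
have [|M [MM SM]] := @exists_maximal R S.
  split; last first.
    by move=> [u [v [Iu Jv e]]]; apply: nx; exists u; rewrite e addrC addKr.
  split; first by exists 0, 0; rewrite addr0.
    move=> _ _ [u [v [Iu Jv ->]]] [u' [v' [Iu' Jv' ->]]].
    by exists (u + u'), (v + v'); split; [exact: IA|exact: JA|rewrite addrACA].
  move=> r _ [u [v [Iu Jv ->]]].
  by exists (r * u), (r * v); split; [exact: IM|exact: JM|rewrite mulrDr].
apply: (h M MM) => x hx; apply: SM; first by exists x, 0; rewrite addr0.
by exists 0, x; rewrite add0r.
Qed.

(** A prime inside both [m] and [m'] would make [R / P] nonlocal: [x] in [m] and [1 - x] in [m']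
    would both be nonunits there. Hence every prime has an element outside [m] or outside [m'], and
    Noetherian induction multiplies the pairs found for larger ideals. *)
Lemma maximal_orthogonal (R : comPzRingType) (m m' : R -> Prop) :
  NIP R -> noetherian R -> maximal_ideal m -> maximal_ideal m' -> m <> m' ->
  exists s s', [/\ ~ m s, ~ m' s' & s * s' = 0].
Proof.
move=> hR noeth mm mm' neq.
have [hm m1 mp] := maximal_prime mm; have [hm' m'1 m'p] := maximal_prime mm'.
pose C (I : R -> Prop) := exists s s', [/\ ~ m s, ~ m' s' & I (s * s')].
suff: C (fun x => x = 0) by [].
apply: (noeth_prime_ind noeth); last exact: zero_ideal.
- by move=> I hI I1; exists 1, 1; rewrite mulr1.
- move=> P pP; apply: contrapT => nC; have [hP P1 PP] := pP.
  have Pm x : P x -> m x.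
    by move=> Px; apply: contrapT => ns; apply: nC; exists x, 1; rewrite mulr1.
  have Pm' x : P x -> m' x.
    by move=> Px; apply: contrapT => ns; apply: nC; exists 1, x; rewrite mul1r.
  have [x [mx m'x]] := distinct_comaximal mm mm' neq.
  have [Q [p [ponto pker [locQ _]]]] := prime_quotient hR noeth pP.
  have nonunit (n : R -> Prop) y : maximal_ideal n -> (forall x, P x -> n x) ->
      n y -> ~ exists z, z * p y = 1.
    move=> [[[n0 nA nM] n1] _] Pn ny [q]; have [z <-] := ponto q => /eqP.
    rewrite -(rmorph1 p) -rmorphM -subr_eq0 -rmorphB => /eqP /pker /Pn h.
    apply: n1; have -> : 1 = z * y + (-1) * (z * y - 1) by ring.
    by apply: (nA); apply: nM.
  have [/(nonunit m x mm Pm mx) //|[M [MM Mx]]] := unit_or_maximal (p x).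
  have [/(nonunit m' _ mm' Pm' m'x) //|[M' [MM' Mx']]] := unit_or_maximal (p (1 - x)).
  move: Mx'; rewrite (maximal_unique locQ MM' MM) rmorphB rmorph1 => Mx'.
  have [[[_ MA _] M1] _] := MM; apply: M1.
  by rewrite -(subrK (p x) 1); apply: MA.
move=> I a b hI Iab [s [s' [ns ns' [u [r [Iu e]]]]]] [t [t' [nt nt' [v [q [Iv e']]]]]].
exists (s * t), (s' * t'); split; [by case/mp|by case/m'p|].
have -> : s * t * (s' * t') = (s * s') * (t * t') by ring.
rewrite e e'.
have -> : (u + r * a) * (v + q * b) =
  (v + q * b) * u + (r * a) * v + (r * q) * (a * b) by ring.
by have [_ IA IM] := hI; apply: (IA); [apply: IA|]; apply: IM.
Qed.

(** The factors are the localizations at the maximal ideals, realized as quotients by the kernels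
    [q i]. By [maximal_orthogonal] only [m i] contains [q i], so the quotients are local and the
    [q i] pairwise comaximal. *)
Lemma NIP_noetherian_product (R : comPzRingType) : NIP R -> noetherian R ->
  exists (n : nat) (Rs : 'I_n -> comNzRingType) (f : R -> forall i, Rs i),
   [/\ bijective f,
       forall x y i, f (x + y) i = f x i + f y i,
       forall x y i, f (x * y) i = f x i * f y i,
       forall i, f 1 i = 1
     & forall i, henselian_local (Rs i)].
Proof.
move=> hR noeth.
have [n [m [[mM mD] mall]]] := NIP_finite_maximal hR.
pose q (i : 'I_n) x := exists s, ~ m i s /\ s * x = 0.
have mi (i : 'I_n) : maximal_ideal (m i) by apply: mM.
have qI i : is_ideal (q i).
  have [hm m1 mp] := maximal_prime (mi i); split; first by exists 1; rewrite mulr0.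
    move=> x y [s [ns e]] [t [nt e']]; exists (s * t); split; first by case/mp.
    have -> : s * t * (x + y) = t * (s * x) + s * (t * y) by ring.
    by rewrite e e' !mulr0 addr0.
  by move=> r x [s [ns e]]; exists s; split=> //; rewrite mulrCA e mulr0.
have qM i (M : R -> Prop) : maximal_ideal M -> (forall x, q i x -> M x) -> M = m i.
  move=> MM qMi; apply: contrapT => /nesym neq.
  have [s [s' [ns ns' e]]] := maximal_orthogonal hR noeth (mi i) MM neq.
  by apply: ns'; apply: qMi; exists s.
have q1 i : ~ q i 1.
  by move=> [s [ns]]; rewrite mulr1 => s0; apply: ns; rewrite s0; case: (mi i) => -[[]].
have /choice[Q QP] : forall i : 'I_n, exists Qp : {Q : comNzRingType & {rmorphism R -> Q}},
    (forall y, exists x, projT2 Qp x = y) /\ (forall x, projT2 Qp x = 0 <-> q i x).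
  move=> i; have [Q [p pP]] := quotient_ring (conj (qI i) (@q1 i) : proper_ideal (q i)).
  by exists (existT _ Q p).
pose Rs i := projT1 (Q i); pose p i : {rmorphism R -> Rs i} := projT2 (Q i).
have ponto i : forall y, exists x, p i x = y by case: (QP i).
have pker i x : p i x = 0 <-> q i x by case: (QP i).
exists n, Rs, (fun x i => p i x).
split; [|by move=> x y i; rewrite rmorphD|by move=> x y i; rewrite rmorphM|
  by move=> i; rewrite rmorph1|]; last first.
  move=> i; apply: local_henselian.
  - exact: NIP_noetherian_quotient hR noeth (qI i) (ponto i) (pker i).
  - exact: noetherian_quotient (ponto i) noeth.
  - have [|M [MM _]] := @exists_maximal (Rs i) (fun x => x = 0).
      by split; [apply: zero_ideal|apply/eqP; apply: oner_neq0].
    have ME (M' : Rs i -> Prop) x : maximal_ideal M' -> M' (p i x) <-> m i x.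
      move=> MM'; rewrite -(qM i _ (preimage_maximal (ponto i) MM')) // => y /pker ->.
      by case: MM' => -[[]].
    by exists M; split=> // M' MM' y; have [x <-] := ponto i y; rewrite !ME.
have inj x y : (forall i, p i x = p i y) -> x = y.
  move=> e; apply/eqP; rewrite -subr_eq0; apply/eqP; apply: contrapT => nz.
  (* The annihilator of a nonzero [x - y] lies in some [m i], whereas membership of [x - y] in [q i]
     gives an annihilating element outside it. *)
  have [|M [MM hM]] := @exists_maximal R (fun s => s * (x - y) = 0).
    split; last by rewrite mul1r.
    split; first by rewrite mul0r.
      by move=> s t hs ht; rewrite mulrDl hs ht addr0.
    by move=> r s hs; rewrite -mulrA hs mulr0.
  have [i [iN ME]] := mall M MM.
  have /(pker (Ordinal iN))[s [ns hs]] : p (Ordinal iN) (x - y) = 0.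
    by rewrite rmorphB e subrr.
  by apply: ns; rewrite -ME; apply: hM.
have co i k : exists u, i != k -> q k u /\ q i (1 - u).
  have [->|ik] := eqVneq i k; first by exists 0.
  have [M MM kM iM|u uP] := comaximal (qI k) (qI i); last by exists u.
  have := qM i M MM iM; rewrite (qM k M MM kM); apply: mD => // e.
  by move/eqP: ik; apply; apply/val_inj/esym.
have /choice[u uP] : forall ik : 'I_n * 'I_n,
    exists u, ik.1 != ik.2 -> q ik.2 u /\ q ik.1 (1 - u).
  by move=> [i k]; apply: co.
(* Lifts of the coordinate idempotents: [e i] maps to [1] in the factor [i] and to [0] in the
   others. *)
pose e i := \prod_(k | k != i) u (i, k).
have eD i : p i (e i) = 1.
  rewrite rmorph_prod big1 // => k ki.
  have [_ /pker] := uP (i, k) (negbT (introF eqP (fun E => elimN eqP ki (esym E)))).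
  by rewrite /= rmorphB rmorph1 => /eqP; rewrite subr_eq0 => /eqP.
have eO i k : k != i -> p k (e i) = 0.
  move=> ki; rewrite rmorph_prod (bigD1 k) //=.
  have [/pker -> _] := uP (i, k) (negbT (introF eqP (fun E => elimN eqP ki (esym E)))).
  by rewrite mul0r.
have surj (y : forall i, Rs i) : exists x, (fun i => p i x) = y.
  have /choice[x xP] : forall i : 'I_n, exists x, p i x = y i by move=> i; apply: ponto.
  exists (\sum_i e i * x i); apply: functional_extensionality_dep => i.
  rewrite rmorph_sum (bigD1 i) //= big1 => [|k ki].
    by rewrite rmorphM eD mul1r xP addr0.
  by rewrite rmorphM eO ?mul0r // eq_sym.
have /choice[h hP] := surj.
exists h => [x|y]; last exact: hP.
by apply: inj => i; have := congr1 (fun y => y i) (hP (fun i => p i x)).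
Qed.

End NIPNoetherian.

Theorem theorem7p9 :
  henselianity_conjecture ->
  (forall R : comPzRingType, NIP R -> noetherian R ->
     exists (n : nat) (Rs : 'I_n -> comNzRingType) (f : R -> forall i, Rs i),
       [/\ bijective f,
           forall x y i, f (x + y) i = f x i + f y i,
           forall x y i, f (x * y) i = f x i * f y i,
           forall i, f 1 i = 1
         & forall i, henselian_local (Rs i)])
  /\
  (forall R : comNzRingType, NIP R -> noetherian R -> integral_domain R ->
     henselian_local R /\ integral_domain R).
Proof.
move=> HC; split=> [R hR noeth|R hR noeth dom]; first exact: NIP_noetherian_product.
by split=> //; apply: domain_henselian.
Qed.
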